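(* Let $(X,\rho)$ be a weighted space with weight function $\rho\ge1$. Consider an operator $A$ on $\mathcal{B}^\rho(X)$ with dense domain $\operatorname{dom}(A)$ generating on $\mathcal{B}^\rho(X)$ a generalized Feller semigroup $(P_t)_{t\ge0}$ of transport type, i.e. $P_tf(x)=f(\psi_t(x))$ for some continuous maps $\psi_t:X\to X$, such that for all $t\ge0$ we have $\|P_t\|_{L(\mathcal{B}^\rho(X))}\le M_1\exp(\omega t)$ for some $M_1$ and $\omega$, and such that $\mathcal{B}^{\sqrt\rho}(X)\subset\mathcal{B}^\rho(X)$ is left invariant and $(P_t)_{t\ge0}$ is strongly continuous thereon. Consider furthermore a family of finite nonnegative measures $\mu(x,\cdot)$, $x\in X$, on $X$ such that the operator $B$ acts on $\mathcal{B}^\rho(X)$ by $$Bf(x):=\int(f(y)-f(x))\,\mu(x,dy),\qquad x\in X,$$ yielding continuous functions on $\{\rho\le R\}$ for $R\ge0$, and such that the following properties hold: (a) For all $x\in X$, $$\int\rho(y)\,\mu(x,dy)\le M\rho^2(x),\qquad\int\sqrt{\rho(y)}\,\mu(x,dy)\le M\rho(x),\qquad\int\mu(x,dy)\le M\sqrt{\rho(x)}$$ for some constant $M$. (b) For some constant $\widetilde\omega\in\mathbb{R}$, $$\int\left|\frac{\sup_{t\ge0}\exp(-\omega t)P_t\rho(y)-\sup_{t\ge0}\exp(-\omega t)P_t\rho(x)}{\sup_{t\ge0}\exp(-\omega t)P_t\rho(x)}\right|\mu(x,dy)\le\widetilde\omega$$ for all $x\in X$; in particular $y\mapsto\sup_{t\ge0}\exp(-\omega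 t)P_t\rho(y)$ should be integrable with respect to $\mu(x,\cdot)$. Then $A+B$ generates a generalized Feller semigroup $(P^\infty_t)_{t\ge0}$ on $\mathcal{B}^\rho(X)$ satisfying $\|P^\infty_t\|_{L(\mathcal{B}^\rho(X))}\le M_1\exp((\omega+\widetilde\omega)t)$.
   Context: A weighted space is a completely regular Hausdorff space $X$ with an admissible weight function $\rho:X\to(0,\infty)$, i.e. $K_R=\{\rho\le R\}$ is compact for all $R>0$. $\mathrm{B}^\rho(X)$ is the Banach space of functions $f:X\to\mathbb{R}$ with $\|f\|_\rho=\sup_x\rho(x)^{-1}|f(x)|<\infty$, and $\mathcal{B}^\rho(X)$ is the closure of $C_b(X)$ in $\mathrm{B}^\rho(X)$; $\mathcal{B}^{\sqrt\rho}(X)$ is defined in the same way with weight $\sqrt\rho$. A generalized Feller semigroup on $\mathcal{B}^\rho(X)$ is a family of bounded linear operators $(P_t)_{t\ge0}$ on $\mathcal{B}^\rho(X)$ with $P_0=I$, $P_{t+s}=P_tP_s$, $\lim_{t\to0}P_tf(x)=f(x)$ for all $f\in\mathcal{B}^\rho(X)$, $x\in X$, $\|P_t\|_{L(\mathcal{B}^\rho(X))}\le C$ for $t\in[0,\varepsilon]$ for some $C$ and $\varepsilon>0$, and $P_tf\ge0$ for $f\ge0$ (it is then strongly continuous). $P_t\rho(x)$ denotes the integral of $\rho$ with respect to the measure representing $f\mapsto P_tf(x)$; for a semigroup of transport type $P_t\rho(x)=\rho(\psi_t(x))$. *)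

(* Defs.v *)
From HB Require Import structures.
From mathcomp Require Import all_boot all_order all_algebra.
From mathcomp Require Import all_classical all_reals all_analysis.

Set Implicit Arguments.
Unset Strict Implicit.
Unset Printing Implicit Defensive.

Import Order.TTheory GRing.Theory Num.Theory.
Import numFieldNormedType.Exports.

Local Open Scope classical_set_scope.
Local Open Scope ring_scope.

Section WeightedSpaces.
Context {R : realType} {X : ptopologicalType}.
Implicit Types (rho : X -> R) (f g : X -> R) (P : R -> (X -> R) -> (X -> R)).

Definition weight_sublevel rho (r : R) : set X := [set x | rho x <= r].

Definition weighted_space rho : Prop :=
  [/\ hausdorff_space X, completely_regular_space X,
      (forall x, 0 < rho x)
    & (forall r, 0 < r -> compact (weight_sublevel rho r))].

(* The real-valued [sup] is [0] by convention on unbounded sets: [wnorm] is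
   the norm only on [bounded_weighted]. *)
Definition wnorm rho f : R := sup (range (fun x => (rho x)^-1 * `|f x|)).

Definition bounded_weighted rho : set (X -> R) :=
  [set f | has_ubound (range (fun x => (rho x)^-1 * `|f x|))].

Definition Cb : set (X -> R) := [set f | continuous f /\ bounded_fun f].

(* The closure of C_b(X) in B^rho(X).  An admissible weight is bounded away
   from zero, so C_b(X) is contained in B^rho(X). *)
Definition calB rho : set (X -> R) :=
  [set f | bounded_weighted rho f /\
     forall e, 0 < e -> exists2 g, Cb g & wnorm rho (f \- g) < e].

(* Operators on [calB rho] are total functions on [X -> R]; their values
   outside [calB rho] (or outside the given domain) are irrelevant. *)

Definition unit_ball_image rho (T : (X -> R) -> (X -> R)) : set R :=
  [set wnorm rho (T f) | f in calB rho `&` [set f | wnorm rho f <= 1]].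

Definition opnorm rho (T : (X -> R) -> (X -> R)) : R :=
  sup (unit_ball_image rho T).

Definition bounded_linear_operator rho (T : (X -> R) -> (X -> R)) : Prop :=
  [/\ (forall f, calB rho f -> calB rho (T f)),
      (forall (a : R) f g, calB rho f -> calB rho g ->
         T (fun x => a * f x + g x) = (fun x => a * T f x + T g x))
    & has_ubound (unit_ball_image rho T)].

Definition densely_defined_operator rho (D : set (X -> R))
    (A : (X -> R) -> (X -> R)) : Prop :=
  [/\ D `<=` calB rho,
      (forall f, D f -> calB rho (A f)),
      (forall (a : R) f g, D f -> D g ->
         D (fun x => a * f x + g x) /\
         A (fun x => a * f x + g x) = (fun x => a * A f x + A g x))
    & (forall f, calB rho f -> forall e, 0 < e ->
         exists2 g, D g & wnorm rho (f \- g) < e)].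

Record generalized_feller_semigroup rho P : Prop := {
  gf_bounded : forall t, 0 <= t -> bounded_linear_operator rho (P t);
  gf_id : forall f, calB rho f -> P 0 f = f;
  gf_semigroup : forall t s, 0 <= t -> 0 <= s ->
    forall f, calB rho f -> P (t + s) f = P t (P s f);
  gf_pointwise : forall f, calB rho f -> forall x,
    P t f x @[t --> 0^'+] --> f x;
  gf_local_bound : exists C eps : R, 0 < eps /\
    forall t, 0 <= t <= eps -> opnorm rho (P t) <= C;
  gf_positive : forall t, 0 <= t -> forall f, calB rho f ->
    (forall x, 0 <= f x) -> forall x, 0 <= P t f x }.

Definition strongly_continuous rho P : Prop :=
  forall f, calB rho f -> wnorm rho (P t f \- f) @[t --> 0^'+] --> (0 : R).

Definition transport_type rho P (psi : R -> X -> X) : Prop :=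
  (forall t, 0 <= t -> continuous (psi t)) /\
  (forall t, 0 <= t -> forall f, calB rho f -> P t f = f \o psi t).

Definition operator_graph (D : set (X -> R)) (A : (X -> R) -> (X -> R)) :
    set ((X -> R) * (X -> R)) :=
  [set (f, A f) | f in D].

(* The graph of the infinitesimal generator, with its maximal domain. *)
Definition generator_graph rho P : set ((X -> R) * (X -> R)) :=
  [set fg | [/\ calB rho fg.1, calB rho fg.2 &
     wnorm rho (fun x => (P t fg.1 x - fg.1 x) / t - fg.2 x) @[t --> 0^'+]
       --> (0 : R)]].

Definition graph_closure rho (G : set ((X -> R) * (X -> R))) :
    set ((X -> R) * (X -> R)) :=
  [set fg | [/\ calB rho fg.1, calB rho fg.2 & forall e, 0 < e ->
     exists2 fg', G fg' & wnorm rho (fg.1 \- fg'.1) < e /\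
                          wnorm rho (fg.2 \- fg'.2) < e]].

Definition generates rho (D : set (X -> R)) (A : (X -> R) -> (X -> R)) P :
    Prop :=
  operator_graph D A = generator_graph rho P.

(* For a sum of two unbounded operators, the generator is the closure of the
   operator on its natural domain, which therefore is a core. *)
Definition closure_generates rho (D : set (X -> R))
    (A : (X -> R) -> (X -> R)) P : Prop :=
  graph_closure rho (operator_graph D A) = generator_graph rho P.

Definition borel_type := g_sigma_algebraType (@open X).

Definition jump_operator (mu : X -> {finite_measure set borel_type -> \bar R})
    f : X -> R :=
  fun x => \int[mu x]_y (f y - f x).

(* [A + B] with its natural domain: the [f] in [dom A] such that [B f] lies
   in [calB rho]. *)
Definition sum_domain rho (D : set (X -> R)) (B : (X -> R) -> (X -> R)) :
    set (X -> R) :=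
  D `&` [set f | calB rho (B f)].

Definition sum_operator (A B : (X -> R) -> (X -> R)) f : X -> R := A f \+ B f.

(* sup_{t >= 0} exp(- omega t) P_t rho (x), where P_t rho = rho \o psi t for a
   semigroup of transport type.  If ||P_t|| <= M1 exp(omega t), the set is
   bounded by M1 * rho x, so that the real-valued [sup] is the true one. *)
Definition sup_weight rho (psi : R -> X -> X) (omega : R) : X -> R :=
  fun x => sup [set expR (- omega * t) * rho (psi t x) | t in [set t | 0 <= t]].

End WeightedSpaces.

Arguments borel_type : clear implicits.

(* Main.v *)
Require Import Defs.
From HB Require Import structures.
From mathcomp Require Import all_boot all_order all_algebra.
From mathcomp Require Import all_classical all_reals all_analysis.
From mathcomp Require Import measurable_realfun.
From mathcomp Require Import ring lra.

(** Adding the jump operator [B] to the generator [A] is a Lumer-Phillips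
    argument in which both conditions, dissipativity and density of the
    range, are obtained from pointwise estimates.

    Dissipativity. The weight [rt x = sup_t exp (- omega t) rho (psi_t x)],
    which is [sup_weight], is equivalent to [rho], lower semicontinuous, and
    satisfies [rt (psi_t x) <= exp (omega t) rt x]. A function [f] of [calB
    rho] is continuous on the compact sublevel sets of [rho] and is [o(rho)]
    outside them, so a negative infimum of [f / rt] is attained
    ([weighted_min]). At a minimum [x], where [f = - c rt], transport along
    the flow gives [A f x >= - c omega rt x] ([gen_at_min]), and the
    integral condition with constant [omega'] gives [B f x >= - c omega' rt
    x] ([jump_at_min]). Hence [A + B - (omega + omega')] is dissipative,
    from below, for the weight [rt]. This yields at once the norm bound and
    positivity.

    Range. The rate of jumps is unbounded, and in general no continuous
    function of [x] cuts it off, because [rho] is only lower semicontinuous.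
    One truncates values instead of rates. For [c > 0] the equation [(lambda
    - A - B) u = g] reads [(lambda + c - A) u = g + (B + c) u]. If [v =
    (lambda + c - A)^-1 g] with [|g| <= m], then [|v| <= m / (lambda + c)],
    and where the total rate is at most [c] one has [|(B + c) v| <= c m /
    (lambda + c)]. Elsewhere, as the rate is at most [M sqrt rho], the
    excess over this bound is at most [2 M^2 m / (c (lambda + c))] times
    [rho] ([jump_bound_excess]). So clamp [(B + c) v] at its nominal bound,
    solve again with the clamped function, which is smaller than [g] by the
    factor [c / (lambda + c)], and sum: the residuals add up to [2 M^2 m /
    (c lambda)], which tends to [0] as [c] grows ([approximate_solution]).
    Clamping keeps a function in [calB rho], because this space is described
    by continuity on the sublevel sets and decay relative to [rho]
    ([calB_intro], by Tietze's theorem, as a sigma-compact regular space is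
    normal).

    Semigroup theory. The Lumer-Phillips theorem ([lumer_phillips]) is
    proved for operators on a closed subspace of the functions bounded
    relative to a weight; the semigroup is the limit of implicit Euler
    schemes with dyadic steps. The same finite-sum estimates, without
    integrals in time, show that the generator of a contraction semigroup is
    closed ([gen_closed]) and has a resolvent ([gen_resolvent]); this is
    used for [A]. *)

Set Implicit Arguments.
Unset Strict Implicit.
Unset Printing Implicit Defensive.

Import Order.TTheory GRing.Theory Num.Theory.
Import numFieldNormedType.Exports.

Local Open Scope classical_set_scope.
Local Open Scope ring_scope.

(** * Weighted bounds, graphs and contraction semigroups *)

Section WeightedBound.
Context {R : realType} {X : Type}.
Implicit Types (w f g : X -> R) (c d e : R).

(** The bound [c] on the weighted norm of [f], as a pointwise predicate: linear
    inequalities between weighted norms are then checked at each point. *)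
Definition wbound w c f := forall x, `|f x| <= c * w x.

Lemma wboundP w c f :
  wbound w c f <-> forall x, - (c * w x) <= f x /\ f x <= c * w x.
Proof.
split=> [h x|h x]; last by rewrite ler_norml; apply/andP; exact: h.
by apply/andP; rewrite -ler_norml.
Qed.

Lemma wboundZ w a c f x : 0 <= a -> wbound w c f ->
  - (a * (c * w x)) <= a * f x /\ a * f x <= a * (c * w x).
Proof.
by move=> a0 /wboundP/(_ x)[h1 h2]; rewrite -mulrN; split; exact: ler_wpM2l.
Qed.

Lemma wbound_ge0 w c f x : 0 < w x -> wbound w c f -> 0 <= c.
Proof.
by move=> wx /(_ x) /(le_trans (normr_ge0 _)); rewrite pmulr_lge0.
Qed.

Lemma wbound_lt0 w c f : (forall x, 0 < w x) -> c < 0 -> wbound w c f ->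
  forall h, wbound w c h.
Proof.
move=> w0 c0 h g x; have := wbound_ge0 (w0 x) h.
by rewrite leNgt c0.
Qed.

Lemma wbound_eps w K c f : (forall x, 0 < w x) ->
  (forall e, 0 < e -> wbound w (c + e * K) f) -> wbound w c f.
Proof.
move=> w0 h x; apply/ler_addgt0Pr => e e0.
have d0 : 0 < (`|K| + 1) * w x.
  by rewrite mulr_gt0// ltr_wpDl.
have := h _ (divr_gt0 e0 d0) x => /le_trans; apply.
rewrite mulrDl lerD2l [leLHS](_ : _ = K * w x / ((`|K| + 1) * w x) * e);
  last by ring.
rewrite ger_pMl// ler_pdivrMr// mul1r ler_pM2r//.
by rewrite (le_trans (ler_norm _))// lerDl.
Qed.

(** The least such bound is the weighted norm. *)
Lemma wbound_least w f : (forall x, 0 < w x) -> (exists c, wbound w c f) ->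
  exists m, [/\ 0 <= m, wbound w m f &
    forall c, 0 <= c -> wbound w c f -> m <= c].
Proof.
move=> w0 [c hc]; pose S := [set `|f x| / w x | x in setT].
have ubS : has_ubound S.
  by exists c => _ [x _ <-]; rewrite ler_pdivrMr//; exact: hc.
have [S0|/set0P[s Ss]] := eqVneq S set0.
  have noX (x : X) : False.
    have : S (`|f x| / w x) by exists x.
    by rewrite S0.
  by exists 0; split => // x; case: (noX x).
have bS x : `|f x| / w x <= sup S by apply: sup_upper_bound => //; [split => //;
  exists s|exists x].
have [x _ _] := Ss.
exists (sup S); split.
- by apply: le_trans (bS x); rewrite divr_ge0// ltW.
- by move=> y; rewrite -ler_pdivrMr.
- move=> c' _ hc'; apply: ge_sup; first by exists s.
  by move=> _ [y _ <-]; rewrite ler_pdivrMr.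
Qed.

Lemma wboundW w c d f : (forall x, 0 < w x) -> c <= d ->
  wbound w c f -> wbound w d f.
Proof. by move=> w0 cd h x; apply: le_trans (h x) _; rewrite ler_pM2r. Qed.

(** A closed subspace of the Banach space of functions bounded relative to [w]. *)
Record closed_subspace w (E : set (X -> R)) : Prop := {
  subspace0 : E (fun=> 0);
  subspace_lin : forall (a : R) f g, E f -> E g -> E (fun x => a * f x + g x);
  subspace_bound : forall f, E f -> exists c, wbound w c f;
  subspace_closed : forall f, (forall e, 0 < e ->
    exists2 g, E g & wbound w e (fun x => f x - g x)) -> E f }.

Definition linear_on (E : set (X -> R)) (T : (X -> R) -> (X -> R)) :=
  forall (a : R) f g, E f -> E g ->
    T (fun x => a * f x + g x) = (fun x => a * T f x + T g x).

Record contraction_semigroup w E (S : R -> (X -> R) -> (X -> R)) : Prop := {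
  csg_stable : forall t, 0 <= t -> forall f, E f -> E (S t f);
  csg_linear : forall t, 0 <= t -> linear_on E (S t);
  csg0 : forall f, E f -> S 0 f = f;
  csgD : forall t s, 0 <= t -> 0 <= s ->
    forall f, E f -> S (t + s) f = S t (S s f);
  csg_contr : forall t, 0 <= t -> forall f, E f ->
    forall c, wbound w c f -> wbound w c (S t f);
  csg_cont : forall f, E f -> forall e, 0 < e -> exists2 d, 0 < d &
    forall t, 0 <= t < d -> wbound w e (fun x => S t f x - f x) }.

(** The infinitesimal generator as a relation, with its maximal domain; the
    difference quotient is multiplied by [t]. *)
Definition gen w E (S : R -> (X -> R) -> (X -> R)) f g : Prop :=
  [/\ E f, E g & forall e, 0 < e -> exists2 d, 0 < d &
    forall t, 0 < t < d -> wbound w (e * t) (fun x => S t f x - f x - t * g x)].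

Definition linear_graph (G : (X -> R) -> (X -> R) -> Prop) :=
  G (fun=> 0) (fun=> 0) /\
  forall (a : R) f g f' g', G f g -> G f' g' ->
    G (fun x => a * f x + f' x) (fun x => a * g x + g' x).

Definition closed_graph w (E : set (X -> R)) (G : (X -> R) -> (X -> R) -> Prop) :=
  forall f g, E f -> E g -> (forall e, 0 < e -> exists f' g',
    [/\ G f' g', wbound w e (fun x => f x - f' x)
      & wbound w e (fun x => g x - g' x)]) -> G f g.

Definition dissipative w (G : (X -> R) -> (X -> R) -> Prop) :=
  forall tau, 0 < tau -> forall f g, G f g -> forall c,
    wbound w c (fun x => f x - tau * g x) -> wbound w c f.

Definition dense_domain w (E : set (X -> R)) (G : (X -> R) -> (X -> R) -> Prop) :=
  forall f, E f -> forall e, 0 < e -> exists f' g',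
    G f' g' /\ wbound w e (fun x => f x - f' x).

Definition dense_range w (E : set (X -> R)) (G : (X -> R) -> (X -> R) ->
  Prop) tau :=
  forall f, E f -> forall e, 0 < e -> exists f' g',
    G f' g' /\ wbound w e (fun x => f x - (f' x - tau * g' x)).

Definition wcauchy w (u : nat -> X -> R) := forall e, 0 < e -> exists n0,
  forall n m, (n0 <= n)%N -> (n0 <= m)%N -> wbound w e (fun x => u n x - u m x).

Definition ptlim (u : nat -> X -> R) : X -> R :=
  fun x => limn (fun n => u n x).

Lemma wcauchy_cvg w u x : 0 < w x -> wcauchy w u ->
  (fun n => u n x) @ \oo --> ptlim u x.
Proof.
move=> w0 cu; suff : cvgn (fun n => u n x) by [].
apply/cauchy_cvgP.
apply/cauchy_ballP => e e0.
have [n0 h] := cu _ (divr_gt0 e0 (mulr_gt0 (ltr0n R 2) w0)).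
near_simpl; near=> p => /=.
rewrite /ball /=.
have : wbound w (e / (2%:R * w x)) (fun x => u p.1 x - u p.2 x).
  apply: h; near: p; [exists ([set n | (n0 <= n)%N], setT)|
                      exists (setT, [set n | (n0 <= n)%N])] => //=;
    try by [split; try exact: filterT; exists n0 | case=> ? ? []].
move=> /(_ x) /le_lt_trans; apply.
rewrite -mulrA invfM -[_ * w x]mulrA mulVf ?gt_eqF// mulr1.
by rewrite ltr_pdivrMr// ltr_pMr// ltr1n.
Unshelve. all: by end_near. Qed.

End WeightedBound.

(** * Generators of contraction semigroups *)

Section Completeness.
Context {R : realType} {X : Type} (w : X -> R) (E : set (X -> R)).
Context (w0 : forall x, 0 < w x).
Context (hE : closed_subspace w E).
Implicit Types (f g : X -> R).

Lemma ptlim_bound (u : nat -> X -> R) n0 c f : wcauchy w u ->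
  (forall m, (n0 <= m)%N -> wbound w c (fun x => f x - u m x)) ->
  wbound w c (fun x => f x - ptlim u x).
Proof.
move=> cu h x.
have ux : (fun n => `|f x - u n x|) @ \oo --> `|f x - ptlim u x|.
  by apply: cvg_norm; apply: cvgB; [exact: cvg_cst|exact: (wcauchy_cvg (w0 x) cu)].
rewrite -(cvg_lim _ ux)//; apply: limr_le; first by apply/cvg_ex; eexists;
  exact: ux.
by exists n0 => // m /= nm; exact: h.
Qed.

Lemma ptlim_in (u : nat -> X -> R) : (forall n, E (u n)) -> wcauchy w u ->
  E (ptlim u).
Proof.
move=> Eu cu; apply: (subspace_closed hE) => e e0; have [n0 h] := cu _ e0.
exists (u n0) => // x; rewrite distrC; move: x.
by apply: (@ptlim_bound _ n0) => // m nm; exact: h.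
Qed.

Lemma subspaceZ a f : E f -> E (fun x => a * f x).
Proof.
move=> Ef; have := subspace_lin hE a Ef (subspace0 hE).
by congr E; apply/funext => x; rewrite addr0.
Qed.

Lemma subspaceD f g : E f -> E g -> E (fun x => f x + g x).
Proof.
move=> Ef Eg; have := subspace_lin hE 1 Ef Eg.
by congr E; apply/funext => x; rewrite mul1r.
Qed.

Lemma subspaceB f g : E f -> E g -> E (fun x => f x - g x).
Proof.
move=> Ef Eg; have := subspace_lin hE (-1) Eg Ef.
by congr E; apply/funext => x; rewrite mulN1r addrC.
Qed.

Section LinearOn.
Context (T : (X -> R) -> X -> R).
Context (hT : linear_on E T).

Lemma linear_on0 : T (fun=> 0) = fun=> 0.
Proof.
have := hT (-1) (subspace0 hE) (subspace0 hE).
rewrite [X in T X](_ : _ = (fun=> 0)); last by apply/funext => x;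
  rewrite mulr0 addr0.
by move=> ->; apply/funext => x; rewrite mulN1r addNr.
Qed.

Lemma linear_onZ a f : E f -> T (fun x => a * f x) = (fun x => a * T f x).
Proof.
move=> Ef; have := hT a Ef (subspace0 hE); rewrite linear_on0.
rewrite [X in T X](_ : _ = (fun x => a * f x)); last by apply/funext => x;
  rewrite addr0.
by move=> ->; apply/funext => x; rewrite addr0.
Qed.

Lemma linear_onD f g : E f -> E g -> T (fun x => f x + g x) = (fun x => T f x + T g
  x).
Proof.
move=> Ef Eg; have := hT 1 Ef Eg.
rewrite [X in T X](_ : _ = (fun x => f x + g x)); last by apply/funext => x;
  rewrite mul1r.
by move=> ->; apply/funext => x; rewrite mul1r.
Qed.

Lemma linear_onB f g : E f -> E g -> T (fun x => f x - g x) = (fun x => T f x - T g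
  x).
Proof.
move=> Ef Eg; have := hT (-1) Eg Ef.
rewrite [X in T X](_ : _ = (fun x => f x - g x)); last by apply/funext => x;
  rewrite mulN1r addrC.
by move=> ->; apply/funext => x; rewrite mulN1r addrC.
Qed.

End LinearOn.

Section MaximalDissipative.
Context (G : (X -> R) -> (X -> R) -> Prop).
Context (GE : forall f g, G f g -> E f /\ E g).
Context (Glin : linear_graph G).

Lemma graphB f g f' g' : G f g -> G f' g' ->
  G (fun x => f x - f' x) (fun x => g x - g' x).
Proof.
move=> Gf Gf'; have := Glin.2 (-1) _ _ _ _ Gf' Gf.
by congr G; apply/funext => x; rewrite mulN1r addrC.
Qed.

(** Approximate solutions of [u - tau v = f] form a Cauchy sequence by
    dissipativity, and the limit is a solution because the graph is closed. *)
Lemma range_full tau : closed_graph w E G -> dissipative w G -> 0 < tau ->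
  dense_range w E G tau ->
  forall f, E f -> exists u v, G u v /\ forall x, u x - tau * v x = f x.
Proof.
move=> Gcl Gdis t0 Grg f Ef.
pose b n : R := 2^-1 ^+ n.
have b0 n : 0 < b n by rewrite exprn_gt0// invr_gt0.
have bs e : 0 < e -> exists n0, forall n, (n0 <= n)%N -> b n <= e.
  move=> e0; have : b @ \oo --> (0 : R).
    by apply: cvg_expr; rewrite gtr0_norm ?invr_gt0// invf_lt1// ltr1n.
  move=> /cvgrPdist_le /(_ _ e0) [n0 _ h]; exists n0 => n nn; have := h n nn.
  by rewrite sub0r normrN ger0_norm// ltW.
have [u hu] := choice (fun n => Grg _ Ef _ (b0 n)).
have [v huv] := choice hu.
have hG n : G (u n) (v n) by have [] := huv n.
have hb n : wbound w (b n) (fun x => f x - (u n x - tau * v n x)) by have [] :=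
  huv n.
have hd n m : wbound w (b n + b m) (fun x => u n x - u m x).
  apply: (Gdis _ t0 _ _ (graphB (hG n) (hG m))).
  apply/wboundP => x; have /wboundP/(_ x)[] := hb n; have /wboundP/(_ x)[] := hb m.
  by move=> *; split; lra.
have cu : wcauchy w u.
  move=> e e0; have [n0 h] := bs _ (divr_gt0 e0 (ltr0n R 2));
    exists n0 => n m nn nm.
  apply: wboundW (hd n m) => //; have := h _ nn; have := h _ nm; lra.
have Eu n : E (u n) by have [] := GE (hG n).
have El := ptlim_in Eu cu.
have hl n0 : wbound w (b n0 + b n0) (fun x => u n0 x - ptlim u x).
  apply: (@ptlim_bound _ n0) => // m nm; apply: wboundW (hd n0 m) => //.
  by rewrite lerD2l /b -(subnK nm) exprD ler_piMl// exprn_ile1// ?invr_ge0//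
    invf_le1// ler1n.
pose v' x := tau^-1 * (ptlim u x - f x).
exists (ptlim u), v'; split; last first.
  by move=> x; rewrite /v' mulrA divff ?gt_eqF// mul1r; ring.
apply: Gcl => //; first by apply: subspaceZ; exact: subspaceB.
move=> e e0.
have e1 : 0 < Num.min (e / 2) (e * tau / 3).
  by rewrite lt_min; apply/andP; split; rewrite ?divr_gt0// ?mulr_gt0.
have [n0 /(_ n0 (leqnn _))] := bs _ e1; rewrite le_min => /andP[be1 be2].
exists (u n0), (v n0); split => //.
  apply/wboundP => x; have /wboundP/(_ x)[] := hl n0.
  have : (b n0 + b n0) * w x <= e * w x by rewrite ler_pM2r//; lra.
  by move=> *; split; lra.
apply/wboundP => x.
have -> : v' x - v n0 x = tau^-1 * (ptlim u x - f x - tau * v n0 x).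
  by rewrite /v'; field; rewrite gt_eqF.
rewrite ler_pdivlMl// ler_pdivrMl//.
have /wboundP/(_ x)[] := hl n0; have /wboundP/(_ x)[] := hb n0.
have : 3 * b n0 * w x <= tau * e * w x by rewrite ler_pM2r//; lra.
by move=> *; split; lra.
Qed.

End MaximalDissipative.
End Completeness.

Section Semigroup.
Context {R : realType} {X : Type} (w : X -> R) (E : set (X -> R)).
Context (w0 : forall x, 0 < w x).
Context (hE : closed_subspace w E).
Context (S : R -> (X -> R) -> (X -> R)).
Context (hS : contraction_semigroup w E S).
Implicit Types (f g : X -> R).
Notation gen := (gen w E S).

Lemma gen_linear : linear_graph gen.
Proof.
split.
  split; try exact: subspace0 hE.
  move=> e e0; exists 1 => // t /andP[t0 _] x;
    rewrite (linear_on0 hE (csg_linear hS (ltW t0))).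
  by rewrite mulr0 !subr0 normr0 !mulr_ge0// ltW.
move=> a f g f' g' [Ef Eg h] [Ef' Eg' h']; split;
  try exact: subspace_lin hE _ _ _ _ _.
move=> e e0; have e1 : 0 < e / (`|a| + 1) by rewrite divr_gt0// ltr_wpDl.
have [d d0 hd] := h _ (divr_gt0 e1 (ltr0n R 2)).
have [d' d0' hd'] := h' _ (divr_gt0 e0 (ltr0n R 2)).
exists (Num.min d d'); first by rewrite lt_min d0.
move=> t /andP[t0]; rewrite lt_min => /andP[td td'] x.
rewrite (csg_linear hS (ltW t0) a Ef Ef').
have -> : a * S t f x + S t f' x - (a * f x + f' x) - t * (a * g x + g' x) =
  a * (S t f x - f x - t * g x) + (S t f' x - f' x - t * g' x) by ring.
rewrite (le_trans (ler_normD _ _))// normrM.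
have /hd/(_ x) H : 0 < t < d by rewrite t0.
have /hd'/(_ x) H' : 0 < t < d' by rewrite t0.
apply: (@le_trans _ _ (`|a| * (e / (`|a| + 1) / 2 * t * w x) + e / 2 * t * w x)).
  by apply: lerD; [rewrite ler_wpM2l//; exact: H|exact: H'].
have -> : `|a| * (e / (`|a| + 1) / 2 * t * w x) = `|a| / (`|a| + 1) * (e / 2 * t *
  w x).
  by field; rewrite gt_eqF// ltr_wpDl.
rewrite [leRHS](_ : _ = e / 2 * t * w x + e / 2 * t * w x); last by field.
rewrite lerD2r ger_pMl; last by rewrite !mulr_gt0// invr_gt0.
by rewrite ler_pdivrMr ?ltr_wpDl// mul1r lerDl.
Qed.

Lemma gen_semigroup s f g : 0 <= s -> gen f g -> gen (S s f) (S s g).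
Proof.
move=> s0 [Ef Eg h]; split; try exact: csg_stable hS _ _ _ _.
move=> e e0; have [d d0 hd] := h _ e0; exists d => // t td.
have t0 : 0 <= t by case/andP: td => /ltW.
have Et := csg_stable hS t0 Ef.
have L := csg_linear hS s0.
have Ed := subspaceB hE Et Ef; have Eg' := subspaceZ hE t Eg.
have := csg_contr hS s0 (subspaceB hE Ed Eg') (hd t td).
rewrite (linear_onB L Ed Eg') (linear_onB L Et Ef) (linear_onZ hE L t Eg).
by rewrite -!(csgD hS)// [s + t]addrC.
Qed.

(** The mean value inequality for [t |-> S t f], whose derivative is [S t g].
    It is obtained by cutting [0, t] into [N] equal steps and summing the
    one-step remainders. *)
Lemma gen_mean_value f g k t c : gen f g -> 0 <= t ->
  (forall s, 0 <= s <= t -> wbound w c (fun x => S s g x - k x)) ->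
  wbound w (t * c) (fun x => S t f x - f x - t * k x).
Proof.
move=> [Ef Eg hfg]; rewrite le_eqVlt => /predU1P[<- _|t0 hk].
  by move=> x; rewrite (csg0 hS)// mul0r subrr subr0 normr0 !mul0r.
apply: (@wbound_eps _ _ _ t) => // e e0; have [d d0 hd] := hfg _ e0.
have [N N0 tN] : exists2 N : nat, (0 < N)%N & t / N%:R < d.
  exists (Num.bound (t / d)).+1 => //; rewrite ltr_pdivrMr// mulrC -ltr_pdivrMr//.
  apply: (lt_le_trans (archi_boundP _)); first by rewrite divr_ge0// ltW.
  by rewrite ler_nat.
pose h := t / N%:R.
have h0 : 0 < h by rewrite divr_gt0// ltr0n.
have hN : h * N%:R = t by rewrite mulfVK// pnatr_eq0 -lt0n.
pose r x := S h f x - f x - h * g x.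
have Er : E r.
  exact: (subspaceB hE (subspaceB hE (csg_stable hS (ltW h0) Ef) Ef) (subspaceZ hE
    h Eg)).
have hr : wbound w (e * h) r by apply: hd; rewrite h0.
suff H n : (n <= N)%N -> wbound w (h * n%:R * (c + e))
    (fun x => S (h * n%:R) f x - f x - h * n%:R * k x).
  by have := H N (leqnn _); rewrite hN; congr wbound; ring.
elim: n => [_ x|n IH nN].
  by rewrite !mulr0 (csg0 hS)// mul0r subrr subr0 normr0 !mul0r.
have hn0 : 0 <= h * n%:R by rewrite mulr_ge0// ltW.
have L := csg_linear hS hn0.
have Shf : S h f = fun x => f x + (h * g x + r x).
  by apply/funext => x; rewrite /r; ring.
have -> : h * n.+1%:R = h * n%:R + h by rewrite mulrSr mulrDr mulr1.
rewrite (csgD hS)//; last exact: ltW.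
rewrite Shf (linear_onD L Ef (subspace_lin hE h Eg Er)).
rewrite (L h _ _ Eg Er).
apply/wboundP => x; have /wboundP/(_ x)[] := IH (ltnW nN).
have /wboundP/(_ x)[] := csg_contr hS hn0 Er hr.
have /(wboundZ x (ltW h0))[] : wbound w c (fun x => S (h * n%:R) g x - k x).
  by apply: hk; rewrite hn0 -hN ler_pM2l// ler_nat ltnW.
by move=> *; split; lra.
Qed.

(** The mean value inequality bounds the remainder of [S t f] uniformly in the
    approximating pairs, since [S s g] is close to [g] for small [s]. *)
Lemma gen_closed : closed_graph w E gen.
Proof.
move=> f g Ef Eg h; split => // e e0.
have [d d0 hd] := csg_cont hS Eg (divr_gt0 e0 (ltr0n R 2)).
exists d => // t /andP[t0 td].
suff H eta : 0 < eta -> wbound w (e / 2 * t + eta * (2 + t)) (fun x => S t f x - f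
  x - t * g x).
  apply: wboundW (wbound_eps (K := 2 + t) w0 _) => [//||eta]; last exact: H.
  by rewrite ler_pM2r//; lra.
move=> eta0; have [f' [g' [fg' ff' gg']]] := h _ eta0.
have [Ef' Eg' _] := fg'.
have : wbound w (t * (e / 2 + eta)) (fun x => S t f' x - f' x - t * g x).
  apply: gen_mean_value fg' (ltW t0) _ => s /andP[s0 st].
  have sd : 0 <= s < d by rewrite s0 (le_lt_trans st).
  have H1 := hd s sd.
  have H2 := csg_contr hS s0 (subspaceB hE Eg Eg') gg'.
  rewrite (linear_onB (csg_linear hS s0))// in H2.
  apply/wboundP => x; have /wboundP/(_ x)[] := H1; have /wboundP/(_ x)[] := H2.
  by move=> *; split; lra.
have H2 := csg_contr hS (ltW t0) (subspaceB hE Ef Ef') ff'.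
rewrite (linear_onB (csg_linear hS (ltW t0)))// in H2.
move=> H1; apply/wboundP => x; have /wboundP/(_ x)[] := H1;
  have /wboundP/(_ x)[] := H2.
have /wboundP/(_ x)[] := ff'.
by move=> *; split; lra.
Qed.

Lemma gen_dissipative : dissipative w gen.
Proof.
move=> tau tau0 f g [Ef Eg hfg] c hc.
have [c0|c0] := ltP c 0; first exact: (wbound_lt0 w0 c0 hc).
have [m [m0 hm mlow]] := wbound_least w0 (subspace_bound hE Ef).
suff : m <= c by move=> mc; exact: wboundW hm.
apply/ler_addgt0Pr => e e0.
have [d d0 hd] := hfg _ (divr_gt0 e0 tau0).
pose t := d / 2; have t0 : 0 < t by rewrite divr_gt0.
have td : 0 < t < d by rewrite t0 /t; lra.
pose q := t / tau; have q0 : 0 < q by rewrite divr_gt0.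
have q1 : 0 < 1 + q by rewrite ltr_wpDl.
have H : wbound w ((m + q * c + e * q) / (1 + q)) f.
  move=> x; rewrite -(ler_pM2l q1) -{1}(gtr0_norm q1) -normrM.
  rewrite mulrA [_ * (_ / _)]mulrCA divff ?gt_eqF// mulr1.
  move: x; apply/wboundP => x.
  have /wboundP/(_ x)[] := hd t td.
  have /wboundP/(_ x)[] := csg_contr hS (ltW t0) Ef hm.
  have [] := wboundZ x (ltW q0) hc.
  have -> : e / tau * t = e * q by rewrite /q; ring.
  have -> : t = q * tau by rewrite mulfVK// gt_eqF.
  by move=> *; split; lra.
have K0 : 0 <= (m + q * c + e * q) / (1 + q).
  by rewrite divr_ge0 ?(ltW q1)// !addr_ge0// mulr_ge0// ltW.
have := mlow _ K0 H; rewrite ler_pdivlMr// => K.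
by rewrite -(ler_pM2l q0); lra.
Qed.

(** For [f] in the domain and a small step [h], the Laplace integral of the
    semigroup is replaced by the sum
    [u = (h / tau) sum_(k < n) q^(k+1) S (h k) f] with [q = tau / (tau + h)].
    As [f - tau g] is [(q^-1 f - S h f) / (h / tau)] up to a small error,
    applying [1 - tau G] to [u] telescopes to [f - q^n S (h n) f]. *)
Lemma gen_range tau : dense_domain w E gen -> 0 < tau -> dense_range w E gen tau.
Proof.
move=> Gd tau0 f0 Ef0 e' e'0.
have [f [g [fg ff0]]] := Gd _ Ef0 _ (divr_gt0 e'0 (ltr0n R 2)).
pose e := e' / 2; have e0 : 0 < e by rewrite divr_gt0.
suff [u [v [uv huv]]] : exists u v, gen u v /\ wbound w e (fun x => f x - (u x -
  tau * v x)).
  exists u, v; split => //; apply/wboundP => x.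
  have /wboundP/(_ x)[] := huv; have /wboundP/(_ x)[] := ff0; rewrite /e => *;
    split; lra.
have [Ef Eg hfg] := fg.
have [d d0 hd] := hfg _ (divr_gt0 e0 (mulr_gt0 tau0 (ltr0n R 2))).
pose h := d / 2; have h0 : 0 < h by rewrite divr_gt0.
have hdh : 0 < h < d by rewrite h0 /h; lra.
pose r x := S h f x - f x - h * g x.
have Er : E r.
  exact: (subspaceB hE (subspaceB hE (csg_stable hS (ltW h0) Ef) Ef) (subspaceZ hE
    h Eg)).
have hr := hd _ hdh.
pose q := tau / (tau + h).
have th0 : 0 < tau + h by rewrite addr_gt0.
have q0 : 0 < q by rewrite divr_gt0.
have q1 : q < 1 by rewrite ltr_pdivrMr// mul1r ltrDl.
have qh : h * q = tau * (1 - q) by rewrite /q; field; rewrite gt_eqF.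
have H n : exists u v, gen u v /\ wbound w (e / 2 * (1 - q ^+ n))
    (fun x => u x - tau * v x - f x + q ^+ n * S (h * n%:R) f x).
  elim: n => [|n [u [v [uv IH]]]].
    exists (fun=> 0), (fun=> 0); split; first exact: gen_linear.1.
    rewrite [h * _]mulr0 (csg0 hS)// => x.
    by rewrite expr0 subrr !mulr0 mul0r mul1r subr0 sub0r addNr normr0.
  have hn0 : 0 <= h * n%:R by rewrite mulr_ge0// ltW.
  have L := csg_linear hS hn0.
  exists (fun x => h / tau * q ^+ n.+1 * S (h * n%:R) f x + u x),
    (fun x => h / tau * q ^+ n.+1 * S (h * n%:R) g x + v x); split.
    by apply: gen_linear.2 => //; exact: gen_semigroup.
  have Shf : S h f = fun x => f x + (h * g x + r x).
    by apply/funext => x; rewrite /r; ring.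
  have -> : h * n.+1%:R = h * n%:R + h by rewrite mulrSr mulrDr mulr1.
  rewrite (csgD hS)//; last exact: ltW.
  rewrite Shf (linear_onD L Ef (subspace_lin hE h Eg Er)).
  rewrite (L h _ _ Eg Er); apply/wboundP => x; have /wboundP/(_ x)[] := IH.
  have qn : 0 < q ^+ n.+1 by rewrite exprn_gt0.
  have [] := wboundZ x (ltW qn) (csg_contr hS hn0 Er hr).
  set F := S _ f x; set K := S _ g x; set r' := S _ r x.
  have tq : tau != 0 by rewrite gt_eqF.
  have hE' : h / tau = (1 - q) / q.
    by apply: (mulIf (_ : q != 0)); [rewrite gt_eqF|rewrite mulrAC qh mulrAC
      divff// mul1r mulfVK// gt_eqF].
  have -> : q ^+ n.+1 * (e / (tau * 2) * h * w x) = e / 2 * (q ^+ n - q ^+ n.+1) *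
    w x.
    rewrite (_ : e / (tau * 2) * h = e / 2 * (h / tau)); last by field.
    by rewrite hE' exprS; field; rewrite gt_eqF.
  have -> : tau * (h / tau * q ^+ n.+1 * K + v x) = h * q ^+ n.+1 * K + tau * v x.
    by field.
  have -> : h / tau * q ^+ n.+1 * F = (q ^+ n - q ^+ n.+1) * F.
    by rewrite hE' exprS; field; rewrite gt_eqF.
  by move=> *; split; lra.
have [m [m0 hm _]] := wbound_least w0 (subspace_bound hE Ef).
have [n hn] : exists n, q ^+ n * m <= e / 2.
  have : (fun n => q ^+ n * m) @ \oo --> (0 * m : R).
    by apply: cvgM; [apply: cvg_expr; rewrite gtr0_norm|exact: cvg_cst].
  rewrite mul0r => /cvgrPdist_le /(_ _ (divr_gt0 e0 (ltr0n R 2))) [n _ /(_ n (leqnn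
    n))].
  by rewrite sub0r normrN => /(le_trans (ler_norm _)); exists n.
have [u [v [uv huv]]] := H n; exists u, v; split => //.
have hn0 : 0 <= h * n%:R by rewrite mulr_ge0// ltW.
apply/wboundP => x; have /wboundP/(_ x)[] := huv.
have qn : 0 < q ^+ n by rewrite exprn_gt0.
have [] := wboundZ x (ltW qn) (csg_contr hS hn0 Ef hm).
have : q ^+ n * m * w x <= e / 2 * w x by rewrite ler_pM2r.
have : 0 < q ^+ n * (e / 2) * w x by rewrite !mulr_gt0// divr_gt0.
by move=> *; split; lra.
Qed.

Lemma gen_resolvent tau : dense_domain w E gen -> 0 < tau ->
  forall f, E f -> exists u v, gen u v /\ forall x, u x - tau * v x = f x.
Proof.
move=> Gd tau0; apply: (range_full w0 hE) => //.
- by move=> f g [].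
- exact: gen_linear.
- exact: gen_closed.
- exact: gen_dissipative.
- exact: gen_range.
Qed.

End Semigroup.

(** * From a resolvent to a semigroup: dyadic implicit Euler schemes *)

Section LumerPhillips.
Context {R : realType} {X : Type} (w : X -> R) (E : set (X -> R)).
Context (w0 : forall x, 0 < w x).
Context (hE : closed_subspace w E).
Context (G : (X -> R) -> (X -> R) -> Prop).
Context (GE : forall f g, G f g -> E f /\ E g).
Context (Glin : linear_graph G).
Context (Gdis : dissipative w G).
Context (Gdense : dense_domain w E G).
Context (V : R -> (X -> R) -> (X -> R)).
Context (hV : forall tau f, 0 < tau -> E f ->
  exists2 k, G (V tau f) k & forall x, V tau f x - tau * k x = f x).
Implicit Types (f g k l : X -> R).

Lemma resolvent_uniq tau f k g : 0 < tau -> E g -> G f k ->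
  (forall x, f x - tau * k x = g x) -> V tau g = f.
Proof.
move=> t0 Eg Gf fk; have [k' Gk' hk'] := hV t0 Eg.
apply/funext => x; apply/eqP; rewrite -subr_eq0 -normr_le0.
have := Gdis t0 (graphB Glin Gk' Gf) (c := 0) _ x; rewrite mul0r; apply => y.
by rewrite mul0r normr_le0 subr_eq0 -subr_eq0; apply/eqP; have := hk' y;
  have := fk y; lra.
Qed.

Lemma resolvent_in tau f : 0 < tau -> E f -> E (V tau f).
Proof. by move=> t0 Ef; have [k /GE[]] := hV t0 Ef. Qed.

Lemma resolvent_contr tau f c : 0 < tau -> E f -> wbound w c f ->
  wbound w c (V tau f).
Proof.
move=> t0 Ef hf; have [k Gk hk] := hV t0 Ef.
by apply: (Gdis t0 Gk) => x; rewrite hk.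
Qed.

Lemma resolvent_linear tau : 0 < tau -> linear_on E (V tau).
Proof.
move=> t0 a f g Ef Eg; have [k Gk hk] := hV t0 Ef; have [k' Gk' hk'] := hV t0 Eg.
apply: (resolvent_uniq t0 (subspace_lin hE a Ef Eg) (Glin.2 a _ _ _ _ Gk Gk')) => x.
by rewrite -hk -hk'; ring.
Qed.

Lemma resolvent_step tau f k : 0 < tau -> G f k ->
  forall x, V tau f x = f x + tau * V tau k x.
Proof.
move=> t0 Gf x; have [Ef Ek] := GE Gf.
have Efk : E (fun x => f x - tau * k x) by exact: (subspaceB hE Ef (subspaceZ hE _
  Ek)).
have := resolvent_uniq t0 Efk Gf (fun=> erefl).
have L := resolvent_linear t0.
by rewrite (linear_onB L Ef (subspaceZ hE _ Ek)) (linear_onZ hE L _ Ek) => /(congr1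
  (fun F => F x)) /=; lra.
Qed.

Lemma resolvent_graph tau f k : 0 < tau -> G f k -> G (V tau f) (V tau k).
Proof.
move=> t0 Gf; have [Ef Ek] := GE Gf; have [v Gv hv] := hV t0 Ef.
suff -> : V tau k = v by [].
apply/funext => x; have := hv x; rewrite (resolvent_step t0 Gf) => H.
by apply: (mulfI (negbT (gt_eqF t0))); lra.
Qed.

Notation Vn n tau := (iter n (V tau)).

Lemma iter_in n tau f : 0 < tau -> E f -> E (Vn n tau f).
Proof. by move=> t0 Ef; elim: n => //= n IH; exact: resolvent_in. Qed.

Lemma iter_contr n tau f c : 0 < tau -> E f -> wbound w c f ->
  wbound w c (Vn n tau f).
Proof.
move=> t0 Ef hf; elim: n => //= n IH; apply: resolvent_contr => //.
exact: iter_in.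
Qed.

Lemma iter_linear n tau : 0 < tau -> linear_on E (Vn n tau).
Proof.
move=> t0 a f g Ef Eg; elim: n => //= n ->.
by rewrite (resolvent_linear t0)//; exact: iter_in.
Qed.

Lemma iter_graph n tau f k : 0 < tau -> G f k -> G (Vn n tau f) (Vn n tau k).
Proof. by move=> t0 Gf; elim: n => //= n IH; exact: resolvent_graph. Qed.

Lemma iter_near n tau f k c : 0 < tau -> G f k -> wbound w c k ->
  wbound w (n%:R * tau * c) (fun x => Vn n tau f x - f x).
Proof.
move=> t0 Gf hk; have [Ef Ek] := GE Gf; elim: n => /= [x|n IH].
  by rewrite subrr normr0 !mul0r.
apply/wboundP => x; have Gn := iter_graph n t0 Gf.
rewrite (resolvent_step t0 Gn).
have [] := wboundZ x (ltW t0) (resolvent_contr t0 (iter_in n t0 Ek) (iter_contr n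
  t0 Ek hk)).
have /wboundP/(_ x)[] := IH; rewrite mulrSr.
by move=> *; split; lra.
Qed.

Lemma resolvent_cvg f : E f -> forall e, 0 < e -> exists2 d, 0 < d &
  forall tau, 0 < tau < d -> wbound w e (fun x => V tau f x - f x).
Proof.
move=> Ef e e0.
have [f' [g' [Gf' ff']]] := Gdense Ef (divr_gt0 e0 (ltr0n R 3)).
have [Ef' Eg'] := GE Gf'.
have [m [m0 hm _]] := wbound_least w0 (subspace_bound hE Eg').
exists (e / 3 / (m + 1)).
  by rewrite !divr_gt0// ltr_wpDl.
move=> tau /andP[t0 td].
have H1 := resolvent_contr t0 (subspaceB hE Ef Ef') ff'.
rewrite (linear_onB (resolvent_linear t0) Ef Ef') in H1.
have := iter_near 1 t0 Gf' hm => /= H2.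
apply/wboundP => x; have /wboundP/(_ x)[] := H1; have /wboundP/(_ x)[] := H2.
have /wboundP/(_ x)[] := ff'.
have : tau * m * w x <= e / 3 * w x.
  rewrite ler_pM2r//; apply: (@le_trans _ _ (tau * (m + 1))).
    by rewrite ler_pM2l// lerDl.
  by rewrite -ler_pdivlMr ?ltr_wpDl// ltW.
by move=> *; split; lra.
Qed.

(** One implicit Euler step of length [2 tau] against two steps of length
    [tau].  The Taylor expansions of the resolvents to second order agree up to
    the first order, and the remainders only involve [l = G (G f)]. *)
Lemma half_step tau f k l c : 0 < tau -> G f k -> G k l -> wbound w c l ->
  wbound w (7 * tau ^+ 2 * c)
    (fun x => V tau (V tau f) x - V (2 * tau) f x).
Proof.
move=> t0 Gf Gk hl; have t2 : 0 < 2 * tau by rewrite mulr_gt0.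
have [_ El] := GE Gk; have [Ef Ek] := GE Gf.
apply/wboundP => x.
have Vl := resolvent_contr t0 El hl; have EVl := resolvent_in t0 El.
have tt : 0 <= tau ^+ 2 by rewrite sqr_ge0.
have [] := wboundZ x tt Vl.
have [] := wboundZ x tt (resolvent_contr t0 EVl Vl).
have [] := wboundZ x tt (resolvent_contr t2 El hl).
rewrite (resolvent_step t0 (resolvent_graph t0 Gf)) (resolvent_step t0 Gf).
rewrite (resolvent_step t0 (resolvent_graph t0 Gk)) (resolvent_step t0 Gk).
rewrite (resolvent_step t2 Gf) (resolvent_step t2 Gk).
by move=> *; split; lra.
Qed.

(** Contractivity turns the local error of [half_step] into a global one. *)
Lemma double_steps n tau f k l c : 0 < tau -> G f k -> G k l -> wbound w c l ->
  wbound w (n%:R * (7 * tau ^+ 2 * c))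
    (fun x => Vn n.*2 tau f x - Vn n (2 * tau) f x).
Proof.
move=> t0 Gf Gk hl; have t2 : 0 < 2 * tau by rewrite mulr_gt0.
have [_ El] := GE Gk; have [Ef Ek] := GE Gf.
elim: n => /= [x|n IH]; first by rewrite subrr normr0 !mul0r.
have hs := half_step t0 (iter_graph n t2 Gf) (iter_graph n t2 Gk) (iter_contr n t2
  El hl).
have E1 := iter_in n.*2 t0 Ef; have E2 := iter_in n t2 Ef.
have L := resolvent_linear t0.
have E3 := subspaceB hE E1 E2.
have H := resolvent_contr t0 (resolvent_in t0 E3) (resolvent_contr t0 E3 IH).
rewrite (linear_onB L E1 E2) (linear_onB L (resolvent_in t0 E1) (resolvent_in t0
  E2)) in H.
apply/wboundP => x; have /wboundP/(_ x)[] := H; have /wboundP/(_ x)[] := hs.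
by rewrite mulrSr; move=> *; split; lra.
Qed.

(** Dyadic meshes: refining one doubles the number of steps up to one extra
    step, so that consecutive approximations can be compared by
    [double_steps]. *)
Definition mesh n : R := 2^-1 ^+ n.
Definition nsteps n (t : R) := Num.truncn (t / mesh n).
Definition euler n t := Vn (nsteps n t) (mesh n).

Lemma mesh_gt0 n : 0 < mesh n.
Proof. by rewrite exprn_gt0// invr_gt0. Qed.

Lemma meshS n : mesh n = 2 * mesh n.+1.
Proof. by rewrite /mesh exprS mulrA divff// mul1r. Qed.

Lemma mesh_small e : 0 < e -> exists n0, forall n, (n0 <= n)%N -> mesh n < e.
Proof.
move=> e0; have : mesh @ \oo --> (0 : R).
  by apply: cvg_expr; rewrite gtr0_norm ?invr_gt0// invf_lt1// ltr1n.
move=> /cvgrPdist_lt /(_ _ e0) [n0 _ h]; exists n0 => n nn; have := h n nn.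
by rewrite sub0r normrN gtr0_norm// mesh_gt0.
Qed.

Lemma nsteps_itv n t : 0 <= t ->
  (nsteps n t)%:R * mesh n <= t < ((nsteps n t)%:R + 1) * mesh n.
Proof.
move=> t0; have m0 := mesh_gt0 n.
have /truncn_itv : 0 <= t / mesh n by rewrite divr_ge0// ltW.
by rewrite ler_pdivlMr// ltr_pdivrMr// natr1.
Qed.

Lemma nstepsS n t : 0 <= t ->
  nsteps n.+1 t = (nsteps n t).*2 \/ nsteps n.+1 t = (nsteps n t).*2.+1.
Proof.
move=> t0; have /andP[a1 a2] := nsteps_itv n t0.
have /andP[b1 b2] := nsteps_itv n.+1 t0.
have m0 := mesh_gt0 n.+1; rewrite meshS in a1 a2.
have H1 : (nsteps n t).*2%:R < (nsteps n.+1 t)%:R + 1 :> R.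
  by rewrite -(ltr_pM2r m0) -muln2 natrM; lra.
have H2 : (nsteps n.+1 t)%:R < (nsteps n t).*2%:R + 1 + 1:> R.
  by rewrite -(ltr_pM2r m0) -muln2 natrM; lra.
rewrite natr1 ltr_nat ltnS in H1; rewrite !natr1 ltr_nat ltnS in H2.
move: H2; rewrite leq_eqVlt => /predU1P[->|H2]; [by right|left].
by apply/eqP; rewrite eqn_leq H1 andbT -ltnS.
Qed.

Lemma nstepsD n s t : 0 <= s -> 0 <= t -> exists b : bool,
  nsteps n (s + t) = (b + (nsteps n s + nsteps n t))%N.
Proof.
move=> s0 t0; have /andP[a1 a2] := nsteps_itv n s0.
have /andP[b1 b2] := nsteps_itv n t0.
have /andP[c1 c2] := nsteps_itv n (addr_ge0 s0 t0).
have m0 := mesh_gt0 n.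
have H1 : (nsteps n s + nsteps n t)%:R < (nsteps n (s + t))%:R + 1 :> R.
  by rewrite -(ltr_pM2r m0) natrD; lra.
have H2 : (nsteps n (s + t))%:R < (nsteps n s + nsteps n t)%:R + 1 + 1:> R.
  by rewrite -(ltr_pM2r m0) natrD; lra.
rewrite natr1 ltr_nat ltnS in H1; rewrite !natr1 ltr_nat ltnS in H2.
move: H2; rewrite leq_eqVlt => /predU1P[->|H2]; [by exists true|exists false => //].
by apply/eqP; rewrite eqn_leq H1 andbT -ltnS.
Qed.

(** The number of steps is at most [t / mesh n], so that the errors of order
    [mesh n ^ 2] made at each step add up to order [mesh n]. *)
Lemma euler_step n t f k l ck cl : 0 <= t -> G f k -> G k l ->
  0 <= ck -> 0 <= cl ->
  wbound w ck k -> wbound w cl l ->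
  wbound w (mesh n * (4 * t * cl + ck)) (fun x => euler n.+1 t f x - euler n t f x).
Proof.
move=> t0 Gf Gk ck0 cl0 hk hl; have m0 := mesh_gt0 n.+1.
have D := double_steps (nsteps n t) m0 Gf Gk hl.
rewrite -meshS in D.
have Gd := iter_graph (nsteps n t).*2 m0 Gf.
have [Ef Ek] := GE Gf.
have := iter_near 1 m0 Gd (iter_contr (nsteps n t).*2 m0 Ek hk).
rewrite mul1r /= => D'.
have B : mesh n.+1 * ((nsteps n t)%:R * mesh n * cl) <= mesh n.+1 * (t * cl).
  rewrite ler_pM2l//; rewrite ler_wpM2r//.
  by have /andP[] := nsteps_itv n t0.
have B2 : 0 <= t * cl by rewrite mulr_ge0.
have B3 : 0 <= mesh n.+1 * (t * cl) by rewrite mulr_ge0// ltW.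
have B4 : 0 <= mesh n.+1 * ck by rewrite mulr_ge0// ltW.
apply: (@wboundW _ _ _ ((nsteps n t)%:R * (7 * mesh n.+1 ^+ 2 * cl) + mesh n.+1 *
  ck)) => //.
  by rewrite (meshS n) in B *; lra.
apply/wboundP => x.
have /wboundP/(_ x)[] := D; have /wboundP/(_ x)[] := D'; have wx := w0 x.
have : 0 <= mesh n.+1 * ck * w x by rewrite mulr_ge0// ltW.
by rewrite /euler; case: (nstepsS n t0) => -> /= *; split; lra.
Qed.

Lemma euler_cauchy_smooth T f k l : G f k -> G k l -> 0 <= T -> exists2 K, 0 < K &
  forall t, 0 <= t <= T -> forall n m, (n <= m)%N ->
    wbound w (K * (mesh n - mesh m)) (fun x => euler m t f x - euler n t f x).
Proof.
move=> Gf Gk T0; have [Ef Ek] := GE Gf; have [_ El] := GE Gk.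
have [ck [ck0 hk _]] := wbound_least w0 (subspace_bound hE Ek).
have [cl [cl0 hl _]] := wbound_least w0 (subspace_bound hE El).
exists (2 * (4 * T * cl + ck) + 1).
  by rewrite ltr_wpDl// mulr_ge0// addr_ge0// !mulr_ge0.
move=> t /andP[t0 tT] n m /subnK <-; elim: (m - n)%N => [|p IH].
  by rewrite add0n subrr mulr0 => x; rewrite subrr normr0 mul0r.
have st := euler_step (p + n) t0 Gf Gk ck0 cl0 hk hl.
have m0 := mesh_gt0 (p + n).+1.
have B : mesh (p + n).+1 * (t * cl) <= mesh (p + n).+1 * (T * cl).
  by rewrite ler_pM2l// ler_wpM2r.
apply: (@wboundW _ _ _ (mesh (p + n) * (4 * t * cl + ck) +
    (2 * (4 * T * cl + ck) + 1) * (mesh n - mesh (p + n)))) => //.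
  by rewrite addSn [mesh (p + n)]meshS; lra.
apply/wboundP => x; have /wboundP/(_ x)[] := st; have /wboundP/(_ x)[] := IH.
by rewrite addSn => *; split; lra.
Qed.

Lemma euler_contr n t f c : E f -> wbound w c f -> wbound w c (euler n t f).
Proof. by move=> Ef hf; apply: iter_contr => //; exact: mesh_gt0. Qed.

Lemma euler_in n t f : E f -> E (euler n t f).
Proof. by move=> Ef; apply: iter_in => //; exact: mesh_gt0. Qed.

Lemma euler_linear n t : linear_on E (euler n t).
Proof. by apply: iter_linear; exact: mesh_gt0. Qed.

Lemma dense_domain_square f e : E f -> 0 < e -> exists f' k l,
  [/\ G f' k, G k l & wbound w e (fun x => f x - f' x)].
Proof.
move=> Ef e0; have e2 : 0 < e / 2 by rewrite divr_gt0.
have [d d0 hd] := resolvent_cvg Ef e2.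
have td : 0 < d / 2 < d by lra.
have t0 : 0 < d / 2 by lra.
have [v Gv hv] := hV t0 Ef.
have [Ev Ev'] := GE Gv.
have [d' d0' hd'] := resolvent_cvg Ev e2.
have sd : 0 < d' / 2 < d' by lra.
have s0 : 0 < d' / 2 by lra.
have [v' Gv' hv'] := hV s0 Ev'.
(* Two resolvents map the space into the domain of the square. *)
exists (V (d' / 2) (V (d / 2) f)), (V (d' / 2) v), v'; split => //.
  exact: resolvent_graph.
apply/wboundP => x; have /wboundP/(_ x)[] := hd _ td;
  have /wboundP/(_ x)[] := hd' _ sd.
by move=> *; split; lra.
Qed.

(** The convergence on the domain of the square of the operator extends to the
    whole space by density and contractivity, uniformly for bounded times. *)
Lemma euler_cauchy T f e : E f -> 0 <= T -> 0 < e -> exists n0,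
  forall t, 0 <= t <= T -> forall n m, (n0 <= n)%N -> (n0 <= m)%N ->
    wbound w e (fun x => euler n t f x - euler m t f x).
Proof.
move=> Ef T0 e0; have e3 : 0 < e / 3 by rewrite divr_gt0.
have [f' [k [l [Gf Gk ff']]]] := dense_domain_square Ef e3.
have [Ef' _] := GE Gf.
have [K K0 hK] := euler_cauchy_smooth Gf Gk T0.
have [n0 hn0] := mesh_small (divr_gt0 e3 K0); exists n0 => t tT.
have H n m : (n0 <= n)%N -> (n <= m)%N ->
    wbound w e (fun x => euler n t f x - euler m t f x).
  move=> nn nm; have A1 := euler_contr n t (subspaceB hE Ef Ef') ff'.
  have A2 := euler_contr m t (subspaceB hE Ef Ef') ff'.
  rewrite (linear_onB (@euler_linear _ _) Ef Ef') in A1.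
  rewrite (linear_onB (@euler_linear _ _) Ef Ef') in A2.
  have A3 : wbound w (e / 3) (fun x => euler m t f' x - euler n t f' x).
    apply: wboundW (hK t tT n m nm) => //.
    have := hn0 _ nn; rewrite ltr_pdivlMr// => M1; have := mulr_gt0 K0 (mesh_gt0 m).
    by lra.
  apply/wboundP => x; have /wboundP/(_ x)[] := A1; have /wboundP/(_ x)[] := A2.
  by have /wboundP/(_ x)[] := A3 => *; split; lra.
move=> n m nn mm; have [nm|/ltnW mn] := leqP n m; first exact: H.
by move=> x; rewrite distrC; exact: H.
Qed.

Definition euler_limit t f : X -> R := ptlim (fun n => euler n t f).
Notation S := euler_limit.

Lemma euler_wcauchy t f : 0 <= t -> E f -> wcauchy w (fun n => euler n t f).
Proof.
move=> t0 Ef e e0; have [n0 h] := euler_cauchy Ef t0 e0; exists n0.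
by apply: h; rewrite t0 lexx.
Qed.

Lemma euler_cvg T f e : E f -> 0 <= T -> 0 < e -> exists n0,
  forall t, 0 <= t <= T -> forall n, (n0 <= n)%N ->
    wbound w e (fun x => euler n t f x - S t f x).
Proof.
move=> Ef T0 e0; have [n0 h] := euler_cauchy Ef T0 e0; exists n0 => t tT n nn.
have t0 : 0 <= t by case/andP: tT.
apply: (ptlim_bound w0 (euler_wcauchy t0 Ef) (n0 := n0)) => m mm.
exact: h.
Qed.

Lemma limit_in t f : 0 <= t -> E f -> E (S t f).
Proof.
move=> t0 Ef; apply: (ptlim_in w0 hE); last exact: euler_wcauchy.
by move=> n; exact: euler_in.
Qed.

Lemma limit_contr t f c : 0 <= t -> E f -> wbound w c f ->
  wbound w c (S t f).
Proof.
move=> t0 Ef hf; apply: (@wbound_eps _ _ _ 1) => // e e0; rewrite mulr1.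
have [n0 /(_ t _ n0 (leqnn _))] := euler_cvg Ef t0 e0.
rewrite t0 lexx => /(_ isT) H.
apply/wboundP => x; have /wboundP/(_ x)[] := H.
have /wboundP/(_ x)[] := euler_contr n0 t Ef hf => *; split; lra.
Qed.

Lemma eq_of_wbound f g : (forall e, 0 < e -> wbound w e (fun x => f x - g x)) ->
  f = g.
Proof.
move=> h; apply/funext => x; apply/eqP; rewrite -subr_eq0 -normr_le0.
have -> : 0 = 0 * w x by rewrite mul0r.
apply: (@wbound_eps _ _ w 1 0 (fun x => f x - g x)) => // e e0.
by rewrite mulr1 add0r; exact: h.
Qed.

Lemma limit_linear t : 0 <= t -> linear_on E (S t).
Proof.
move=> t0 a f g Ef Eg; apply: eq_of_wbound => e e0.
have e1 : 0 < e / (`|a| + 2) by rewrite divr_gt0// ltr_wpDl.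
have [n1 h1] := euler_cvg (subspace_lin hE a Ef Eg) t0 e1.
have [n2 h2] := euler_cvg Ef t0 e1.
have [n3 h3] := euler_cvg Eg t0 e1.
have tt : 0 <= t <= t by rewrite t0 lexx.
pose n := maxn n1 (maxn n2 n3).
have := h1 t tt n (leq_maxl _ _).
have := h2 t tt n (leq_trans (leq_maxl _ _) (leq_maxr _ _)).
have := h3 t tt n (leq_trans (leq_maxr _ _) (leq_maxr _ _)).
rewrite (@euler_linear n t a f g Ef Eg) => H3 H2 H1 x.
have {}H1 := H1 x; have {}H2 := H2 x; have {}H3 := H3 x.
rewrite [X in `|X|](_ : _ = - (a * euler n t f x + euler n t g x - S t (fun x0 : X
  => a * f x0 + g x0) x) +
   (a * (euler n t f x - S t f x) + (euler n t g x - S t g x))); last by ring.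
rewrite (le_trans (ler_normD _ _))// normrN.
rewrite (le_trans (lerD H1 (ler_normD _ _)))// normrM.
rewrite (le_trans (lerD (lexx _) (lerD (ler_wpM2l (normr_ge0 _) H2) H3)))//.
rewrite [leLHS](_ : _ = e * w x)//; field.
by rewrite gt_eqF// ltr_wpDl.
Qed.

Lemma limit_id f : E f -> S 0 f = f.
Proof.
move=> Ef; apply: eq_of_wbound => e e0.
have [n0 /(_ 0 _ n0 (leqnn _))] := euler_cvg Ef (lexx 0) e0.
rewrite lexx => /(_ isT); rewrite {1}/euler /nsteps mul0r truncn0 /= => H x.
by rewrite distrC; exact: H.
Qed.

(** The step counts satisfy the semigroup law up to one step, and a single
    resolvent of small parameter is close to the identity. *)
Lemma limit_add t s f : 0 <= t -> 0 <= s -> E f -> S (t + s) f = S t (S s f).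
Proof.
move=> t0 s0 Ef; apply: eq_of_wbound => e e0.
have e4 : 0 < e / 4 by rewrite divr_gt0.
have [n1 /(_ (t + s))h1] := euler_cvg Ef (addr_ge0 t0 s0) e4.
have [n2 /(_ t)h2] := euler_cvg (limit_in s0 Ef) t0 e4.
have [n3 /(_ s)h3] := euler_cvg Ef s0 e4.
have [d d0 hd] := resolvent_cvg Ef e4; have [n4 h4] := mesh_small d0.
pose n := maxn (maxn n1 n2) (maxn n3 n4).
have nn1 : (n1 <= n)%N := leq_trans (leq_maxl _ _) (leq_maxl _ _).
have nn2 : (n2 <= n)%N := leq_trans (leq_maxr _ _) (leq_maxl _ _).
have nn3 : (n3 <= n)%N := leq_trans (leq_maxl _ _) (leq_maxr _ _).
have nn4 : (n4 <= n)%N := leq_trans (leq_maxr _ _) (leq_maxr _ _).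
have H1 := h1 _ n nn1; rewrite addr_ge0// lexx in H1; have {}H1 := H1 isT.
have H2 := h2 _ n nn2; rewrite t0 lexx in H2; have {}H2 := H2 isT.
have H3 := h3 _ n nn3; rewrite s0 lexx in H3; have {}H3 := H3 isT.
have Es := euler_in n s Ef; have ES := limit_in s0 Ef.
have H4 := euler_contr n t (subspaceB hE Es ES) H3.
rewrite (linear_onB (@euler_linear _ _) Es ES) in H4.
have m0 := mesh_gt0 n.
have H5 : wbound w (e / 4) (fun x => euler n (t + s) f x - euler n t (euler n s f)
  x).
  have [b ns] := nstepsD n t0 s0.
  rewrite /euler ns; case: b {ns}; last first.
    by rewrite add0n iterD => x; rewrite subrr normr0 mulr_ge0// ltW.
  rewrite add1n iterSr -iterD.
  have M := hd (mesh n); rewrite m0 h4// in M; have {}M := M isT.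
  have := iter_contr (nsteps n t + nsteps n s) m0 (subspaceB hE (resolvent_in m0
    Ef) Ef) M.
  by rewrite (linear_onB (@iter_linear _ _ m0) (resolvent_in m0 Ef) Ef).
apply/wboundP => x; have /wboundP/(_ x)[] := H1; have /wboundP/(_ x)[] := H2.
have /wboundP/(_ x)[] := H4; have /wboundP/(_ x)[] := H5.
by move=> *; split; lra.
Qed.

(** Telescoping the Euler scheme gives a mesh-weighted sum of iterates of the
    resolvent applied to [k], and these stay close to [k] for short times. *)
Lemma limit_taylor f k : G f k -> forall e, 0 < e -> exists2 d, 0 < d &
  forall t, 0 <= t < d -> wbound w (e * t) (fun x => S t f x - f x - t * k x).
Proof.
move=> Gf e e0; have [Ef Ek] := GE Gf.
have [k' [l [Gk' kk']]] := Gdense Ek (divr_gt0 e0 (ltr0n R 4)).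
have [Ek' El] := GE Gk'.
have [m [m0 hm _]] := wbound_least w0 (subspace_bound hE El).
have [c [c0 hc _]] := wbound_least w0 (subspace_bound hE Ek).
have m1 : 0 < m + 1 by rewrite ltr_wpDl.
exists (e / 4 / (m + 1)); first by rewrite !divr_gt0.
move=> t /andP[t0 td].
have tm : t * m <= e / 4.
  have : t * (m + 1) <= e / 4 by rewrite -ler_pdivlMr// ltW.
  by lra.
apply: (@wbound_eps _ _ _ 1) => // eta eta0; rewrite mulr1.
have eta2 : 0 < eta / 2 by rewrite divr_gt0.
have [n1 /(_ t)h1] := euler_cvg Ef t0 eta2.
have [n2 h2] := mesh_small (divr_gt0 eta2 (ltr_wpDl c0 ltr01 : 0 < c + 1)).
have [n3 h3] := mesh_small (divr_gt0 (divr_gt0 e0 (ltr0n R 4)) m1).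
pose n := maxn n1 (maxn n2 n3).
have H1 := h1 _ n (leq_maxl _ _); rewrite t0 lexx in H1; have {}H1 := H1 isT.
have := h2 n (leq_trans (leq_maxl _ _) (leq_maxr _ _)).
have := h3 n (leq_trans (leq_maxr _ _) (leq_maxr _ _)).
have h0 := mesh_gt0 n; set h := mesh n in h0 *.
rewrite !ltr_pdivlMr ?ltr_wpDl// => hm1 hc1.
have hm2 : h * m <= e / 4 by rewrite mulrDr mulr1 in hm1; lra.
have hc2 : h * c <= eta / 2 by rewrite mulrDr mulr1 in hc1; lra.
have /andP[N1 N2] := nsteps_itv n t0; rewrite -/h in N1 N2.
have K i : i%:R * h <= t + h -> wbound w e (fun x => Vn i h k x - k x).
  move=> it; have A1 := iter_contr i h0 (subspaceB hE Ek Ek') kk'.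
  rewrite (linear_onB (@iter_linear _ _ h0) Ek Ek') in A1.
  have A2 := iter_near i h0 Gk' hm.
  apply/wboundP => x; have /wboundP/(_ x)[] := A1; have /wboundP/(_ x)[] := A2.
  have /wboundP/(_ x)[] := kk'.
  have : i%:R * h * m * w x <= (e / 4 + e / 4) * w x.
    rewrite ler_pM2r//; apply: (@le_trans _ _ ((t + h) * m)); last by lra.
    by rewrite ler_wpM2r.
  by move=> *; split; lra.
have H2 N : N%:R * h <= t ->
    wbound w (N%:R * h * e) (fun x => Vn N h f x - f x - N%:R * h * k x).
  elim: N => [_ x|N IH Nt]; first by rewrite /= !mul0r subrr subr0 normr0.
  have Nt' : N%:R * h <= t by move: Nt; rewrite mulrSr; lra.
  have KN := K N.+1 _; apply/wboundP => x.
  have /wboundP/(_ x)[] := IH Nt'.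
  rewrite /= (resolvent_step h0 (iter_graph N h0 Gf)).
  have [] := wboundZ x (ltW h0) (KN _); first by move: Nt; lra.
  by rewrite mulrSr /= => *; split; lra.
have {}H2 := H2 _ N1.
have B : (t - (nsteps n t)%:R * h) * c <= eta / 2.
  by apply: le_trans hc2; rewrite ler_wpM2r//; lra.
apply/wboundP => x; have /wboundP/(_ x)[] := H2; have /wboundP/(_ x)[] := H1.
have tn : 0 <= t - (nsteps n t)%:R * h by lra.
have [] := wboundZ x tn hc.
have : (t - (nsteps n t)%:R * h) * c * w x <= eta / 2 * w x by rewrite ler_pM2r.
have : (nsteps n t)%:R * h * e * w x <= t * e * w x.
  by rewrite ler_pM2r// ler_pM2r.
rewrite /euler -/h.
by move=> *; split; lra.
Qed.

Lemma limit_semigroup : contraction_semigroup w E S.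
Proof.
split.
- by move=> t t0 f; exact: limit_in.
- exact: limit_linear.
- exact: limit_id.
- by move=> t s t0 s0 f; exact: limit_add.
- by move=> t t0 f Ef c; exact: limit_contr.
move=> f Ef e e0; have e3 : 0 < e / 3 by rewrite divr_gt0.
have [f' [k [Gf' ff']]] := Gdense Ef e3.
have [Ef' Ek] := GE Gf'.
have [c [c0 hc _]] := wbound_least w0 (subspace_bound hE Ek).
have [d d0 hd] := limit_taylor Gf' e0.
have c1 : 0 < c + e + 1 by rewrite !ltr_wpDl// addr_ge0// ltW.
exists (Num.min d (e / 3 / (c + e + 1))).
  by rewrite lt_min d0 !divr_gt0.
move=> t /andP[t0]; rewrite lt_min => /andP[td]; rewrite ltr_pdivlMr// => tc.
have A1 := limit_contr t0 (subspaceB hE Ef Ef') ff'.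
rewrite (linear_onB (limit_linear t0) Ef Ef') in A1.
have A2 := hd t _; rewrite t0 td in A2; have {}A2 := A2 isT.
apply/wboundP => x; have /wboundP/(_ x)[] := A1; have /wboundP/(_ x)[] := A2.
have /wboundP/(_ x)[] := ff'; have [] := wboundZ x t0 hc.
have : t * (c + e + 1) * w x <= e / 3 * w x by rewrite ler_pM2r// ltW.
have : 0 <= t * w x by rewrite mulr_ge0// ltW.
by move=> *; split; lra.
Qed.

(** A generator extending the operator coincides with it, as [1 - G] is already
    onto and the generator is dissipative. *)
Lemma limit_gen f k : gen w E S f k <-> G f k.
Proof.
have sub f' k' : G f' k' -> gen w E S f' k'.
  move=> Gf'; have [Ef' Ek'] := GE Gf'; split => // e e0.
  have [d d0 hd] := limit_taylor Gf' e0; exists d => // t /andP[t0 td].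
  by apply: hd; rewrite ltW.
split; last exact: sub.
move=> gf; have [Ef Ek _] := gf.
have Efk := subspaceB hE Ef Ek.
have [v Gv hv] := hV ltr01 Efk.
have H := gen_dissipative w0 hE limit_semigroup ltr01
  (graphB (gen_linear w0 hE limit_semigroup) gf (sub _ _ Gv)) (c := 0) _.
have fV : f = V 1 (fun x => f x - k x).
  apply/funext => x; apply/eqP; rewrite -subr_eq0 -normr_le0.
  rewrite -[leRHS](mul0r (w x)); apply: H => y.
  by rewrite mul0r normr_le0; apply/eqP; have := hv y; lra.
have kv : k = v by apply/funext => x; have := hv x; rewrite -fV; lra.
by move: Gv; rewrite -fV -kv.
Qed.

(** Order bounds kept by the resolvents pass to the Euler scheme, hence to the
    limit; with [c = 0] this is positivity. *)
Lemma limit_lower t f c : 0 <= t -> E f ->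
  (forall tau, 0 < tau -> forall g, E g -> (forall x, - (c * w x) <= g x) ->
     forall x, - (c * w x) <= V tau g x) ->
  (forall x, - (c * w x) <= f x) -> forall x, - (c * w x) <= S t f x.
Proof.
move=> t0 Ef pV hf x.
have H n : forall x, - (c * w x) <= euler n t f x.
  rewrite /euler; elim: (nsteps n t) => //= p IH; apply: pV => //.
    exact: mesh_gt0.
  by apply: iter_in => //; exact: mesh_gt0.
apply/ler_addgt0Pl => e e0.
have [n0 /(_ t _ n0 (leqnn _))] := euler_cvg Ef t0 (divr_gt0 e0 (w0 x)).
rewrite t0 lexx => /(_ isT) /(_ x); rewrite mulfVK ?gt_eqF// ler_norml => /andP[_].
by have := H n0 x; lra.
Qed.

End LumerPhillips.

(** * The Lumer-Phillips theorem *)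

Section GraphClosure.
Context {R : realType} {X : Type} (w : X -> R) (E : set (X -> R)).
Context (w0 : forall x, 0 < w x).
Context (hE : closed_subspace w E).
Context (G : (X -> R) -> (X -> R) -> Prop).
Context (GE : forall f g, G f g -> E f /\ E g).
Implicit Types (f g k : X -> R).

Definition closure_of_graph f k := [/\ E f, E k & forall e, 0 < e ->
  exists f' k', [/\ G f' k', wbound w e (fun x => f x - f' x)
    & wbound w e (fun x => k x - k' x)]].

(** Dissipativity tested from below: it contains both the norm estimate (apply
    it to [f] and [- f]) and the positivity of the resolvent (take [c = 0]). *)
Definition lower_dissipative := forall tau, 0 < tau -> forall f k, G f k ->
  forall c, 0 <= c -> (forall x, - (c * w x) <= f x - tau * k x) ->
  forall x, - (c * w x) <= f x.

Lemma sub_closure f k : G f k -> closure_of_graph f k.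
Proof.
move=> Gf; have [Ef Ek] := GE Gf; split => // e e0; exists f, k.
by split => // x; rewrite subrr normr0 mulr_ge0// ltW.
Qed.

End GraphClosure.

Section LumerPhillipsTheorem.
Context {R : realType} {X : Type} (w : X -> R) (E : set (X -> R)).
Context (w0 : forall x, 0 < w x).
Context (hE : closed_subspace w E).
Context (G : (X -> R) -> (X -> R) -> Prop).
Context (GE : forall f g, G f g -> E f /\ E g).
Context (Glin : linear_graph G).
Context (Gdis : lower_dissipative w G).
Context (Gdense : dense_domain w E G).
Context (Grange : forall tau, 0 < tau -> dense_range w E G tau).
Implicit Types (f g k : X -> R).
Notation Gc := (closure_of_graph w E G).

Lemma closure_linear : linear_graph Gc.
Proof.
split; first by apply: sub_closure => //; exact: Glin.1.
move=> a f g f' g' [Ef Eg h] [Ef' Eg' h']; split;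
  [exact: (subspace_lin hE)|exact: (subspace_lin hE)|].
move=> e e0; have e2 : 0 < e / 2 by rewrite divr_gt0.
have a1 : 0 < `|a| + 1 by rewrite ltr_wpDl.
have [p [q [Gp fp gq]]] := h _ (divr_gt0 e2 a1).
have [p' [q' [Gp' fp' gq']]] := h' _ e2.
exists (fun x => a * p x + p' x), (fun x => a * q x + q' x).
have K u v u' v' : wbound w (e / 2 / (`|a| + 1)) (fun x => u x - v x) ->
    wbound w (e / 2) (fun x => u' x - v' x) ->
    wbound w e (fun x => a * u x + u' x - (a * v x + v' x)).
  move=> h1 h2 x.
  rewrite [X in `|X|](_ : _ = a * (u x - v x) + (u' x - v' x)); last by ring.
  apply: le_trans (ler_normD _ _) _; rewrite normrM.
  have H : `|a| * `|u x - v x| <= (`|a| + 1) * (e / 2 / (`|a| + 1) * w x).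
    by apply: ler_pM => //; rewrite ?lerDl.
  apply: le_trans (lerD H (h2 x)) _.
  rewrite [leLHS](_ : _ = e * w x)//; field.
  by rewrite gt_eqF.
by split; [exact: Glin.2|exact: K|exact: K].
Qed.

Lemma closure_lower_dissipative : lower_dissipative w Gc.
Proof.
move=> tau tau0 f k [Ef Ek h] c c0 hc x.
apply/ler_addgt0Pr => e e0.
pose K := (2 + tau) * w x.
have K0 : 0 < K by rewrite mulr_gt0// ltr_wpDl// ltW.
have d0 := divr_gt0 e0 K0.
have [f' [k' [Gf' ff' kk']]] := h _ d0.
have c1 : 0 <= c + e / K * (1 + tau).
  by rewrite addr_ge0// mulr_ge0 ?(ltW d0)// addr_ge0// ltW.
have : - ((c + e / K * (1 + tau)) * w x) <= f' x.
  apply: (Gdis tau0 Gf' c1) => y; have := hc y; have /wboundP/(_ y)[] := ff'.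
  by have [] := wboundZ y (ltW tau0) kk'; lra.
have /wboundP/(_ x)[] := ff'.
have : e = e / K * ((2 + tau) * w x) by rewrite mulfVK// gt_eqF.
by lra.
Qed.

Lemma lower_dissipativeW H : linear_graph H -> lower_dissipative w H ->
  dissipative w H.
Proof.
move=> Hlin Hd tau tau0 f k Hf c hc.
have [c0|c0] := ltP c 0; first exact: (wbound_lt0 w0 c0 hc).
apply/wboundP => x; split.
  by apply: (Hd tau tau0 f k) => // y; have /wboundP/(_ y)[] := hc.
rewrite -lerN2.
have HN : H (fun x => - f x) (fun x => - k x).
  have := Hlin.2 (-1) _ _ _ _ Hf Hlin.1.
  by congr H; apply/funext => y; rewrite mulN1r addr0.
apply: (Hd tau tau0 _ _ HN) => // y.
by have /wboundP/(_ y)[] := hc; lra.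
Qed.

Lemma closure_closed : closed_graph w E Gc.
Proof.
move=> f k Ef Ek h; split => // e e0; have e2 : 0 < e / 2 by rewrite divr_gt0.
have [f' [k' [[_ _ h'] ff' kk']]] := h _ e2.
have [f'' [k'' [Gf'' ff'' kk'']]] := h' _ e2.
exists f'', k''; split => //; apply/wboundP => x.
  have /wboundP/(_ x)[] := ff'; have /wboundP/(_ x)[] := ff''.
  by move=> *; split; lra.
have /wboundP/(_ x)[] := kk'; have /wboundP/(_ x)[] := kk''.
by move=> *; split; lra.
Qed.

Theorem lumer_phillips : exists S,
  [/\ contraction_semigroup w E S,
      forall f k, gen w E S f k <-> Gc f k
    & forall t f, 0 <= t -> E f -> (forall x, 0 <= f x) -> forall x, 0 <= S t f x].
Proof.
have GcE f k : Gc f k -> E f /\ E k by case.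
have Gcd := lower_dissipativeW closure_linear closure_lower_dissipative.
have Gcdense : dense_domain w E Gc.
  move=> f Ef e e0; have [f' [k' [Gf' ff']]] := Gdense Ef e0.
  by exists f', k'; split => //; exact: sub_closure.
have V tau : exists V : (X -> R) -> X -> R, 0 < tau -> forall f, E f ->
    exists2 k, Gc (V f) k & forall x, V f x - tau * k x = f x.
  have H f : exists u, 0 < tau -> E f ->
      exists2 k, Gc u k & forall x, u x - tau * k x = f x.
    have [t0|] := pselect (0 < tau); last by exists (fun=> 0).
    have [Ef|] := pselect (E f); last by exists (fun=> 0).
    have rg : dense_range w E Gc tau.
      move=> g Eg e e0; have [u [v [Gu hu]]] := Grange t0 Eg e0.
      by exists u, v; split => //; exact: sub_closure.
    have [u [v [Gu hu]]] := range_full w0 hE GcE closure_linear closure_closed Gcd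
      t0 rg Ef.
    by exists u => _ _; exists v.
  have [V hV] := choice H; exists V => t0 f; exact: hV.
have [{}V hV] := choice V.
have hV' tau f : 0 < tau -> E f -> exists2 k, Gc (V tau f) k & forall x, V tau f x
  - tau * k x = f x.
  by move=> t0; exact: hV.
exists (euler_limit V); split.
- exact: (limit_semigroup w0 hE GcE closure_linear Gcd Gcdense hV').
- exact: (limit_gen w0 hE GcE closure_linear Gcd Gcdense hV').
move=> t f t0 Ef f0 x.
suff : - (0 * w x) <= euler_limit V t f x by rewrite mul0r oppr0.
apply: (limit_lower w0 hE GcE closure_linear Gcd Gcdense hV') => //.
  move=> tau tau0 g Eg g0 y; have [k Gk hk] := hV' tau g tau0 Eg.
  by apply: (closure_lower_dissipative tau0 Gk (lexx 0)) => z; rewrite hk.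
by move=> y; rewrite mul0r oppr0.
Qed.

End LumerPhillipsTheorem.

(** * Normality of sigma-compact regular spaces *)

Section SigmaCompact.

(** If [Q K] failed, the sets [S] such that [Q] holds for the points of [K]
    outside [S] would form a proper filter without cluster point in [K]. *)
Lemma compact_induction (T : topologicalType) (K : set T) (Q : set T -> Prop) :
  compact K -> Q set0 -> (forall A B, Q A -> Q B -> Q (A `|` B)) ->
  (forall A B, A `<=` B -> Q B -> Q A) ->
  (forall x, K x -> exists2 U, nbhs x U & Q U) -> Q K.
Proof.
move=> cK Q0 QU QS Qloc; apply: contrapT => nQ.
pose F : set_system T := [set S | Q (K `\` S)].
have FF : ProperFilter F.
  split; first by rewrite /F /= setD0.
  split; first by rewrite /F /= setDT.
    by move=> A B; rewrite /F /= setDIr; exact: QU.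
  by move=> A B AB; rewrite /F /=; apply: QS; exact: setDS.
have FK : F K by rewrite /F /= setDv.
have [x [Kx clx]] := cK F FF FK.
have [U nU QU'] := Qloc x Kx.
have FU : F (~` U) by rewrite /F /= setDE setCK; apply: QS QU'; exact: subIsetr.
by have [y []] := clx _ _ FU nU.
Qed.

Lemma regular_compact_closed (T : topologicalType) (K B : set T) :
  @regular_space T -> compact K -> closed B -> K `&` B = set0 ->
  exists U, [/\ open U, K `<=` U & closure U `&` B = set0].
Proof.
move=> rT cK clB KB.
pose Q S := exists U : set T, [/\ open U, S `<=` U & closure U `&` B = set0].
apply: (@compact_induction T K Q) => //.
- by exists set0; split; [exact: open0|by []|rewrite closure0 set0I].
- move=> A C [U [oU AU UB]] [U' [oU' CU UB']]; exists (U `|` U'); split.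
  + exact: openU.
  + exact: setUSS.
  + by rewrite closureU setIUl UB UB' setU0.
- by move=> A C AC [U [oU CU UB]]; exists U; split => //; exact: subset_trans CU.
move=> x Kx.
have nB : nbhs x (~` B).
  apply: open_nbhs_nbhs; split; first exact: closed_openC.
  by move=> Bx; have : (K `&` B) x by []; rewrite KB.
have [U nU cU] := rT x _ nB.
exists U°; first exact: nbhs_interior.
exists U°; split => //; first exact: open_interior.
apply/disjoints_subset; apply: subset_trans cU.
exact: closureS (@interior_subset _ _).
Qed.

(** The classical argument for Lindelof spaces: countably many neighbourhoods
    of each of the two sets, trimmed by the closures of the previous ones on the
    other side. *)
Lemma sigma_compact_normal (R : realType) (T : topologicalType) (K : nat -> set T) :
  @regular_space T -> (forall n, compact (K n)) -> (forall x, exists n, K n x) ->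
  normal_space T.
Proof.
move=> rT cK KT; apply/(@normal_openP R T) => A B clA clB AB.
have sep C C' : closed C -> closed C' -> C `&` C' = set0 -> forall n,
    exists U, [/\ open U, C `&` K n `<=` U & closure U `&` C' = set0].
  move=> clC clC' CC n; apply: regular_compact_closed => //.
    by rewrite setIC; exact: compact_closedI.
  by rewrite setIAC CC set0I.
have [U hU] := choice (sep A B clA clB AB).
have [V hV] := choice (sep B A clB clA (etrans (setIC _ _) AB)).
have closedD (W : nat -> set T) n : closed (\bigcup_(k in `I_n.+1) closure (W k)).
  by apply: closed_bigcup => [|i _]; [exact: finite_II|exact: closed_closure].
pose P (W W' : nat -> set T) n := W n `\` \bigcup_(k in `I_n.+1) closure (W' k).
have oP W W' n : open (W n) -> open (P W W' n).
  by move=> oW; rewrite /P setDE; apply: openI => //; exact: closed_openC.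
exists (\bigcup_n P U V n), (\bigcup_n P V U n); split.
- by apply: bigcup_open => n _; apply: oP; case: (hU n).
- by apply: bigcup_open => n _; apply: oP; case: (hV n).
- move=> x Ax; have [n Kx] := KT x; exists n => //; split.
    by have [_ + _] := hU n; apply.
  move=> [k _ cVx]; have [_ _ /disjoints_subset VA] := hV k.
  exact: VA cVx Ax.
- move=> x Ax; have [n Kx] := KT x; exists n => //; split.
    by have [_ + _] := hV n; apply.
  move=> [k _ cVx]; have [_ _ /disjoints_subset VA] := hU k.
  exact: VA cVx Ax.
- rewrite -subset0 => x [[n _ [Ux nV]] [m _ [Vx nU]]].
  have [nm|/ltnW mn] := leqP n m.
    apply: nU; exists n; first by rewrite /= ltnS.
    exact: subset_closure.
  apply: nV; exists m; first by rewrite /= ltnS.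
  exact: subset_closure.
Qed.

End SigmaCompact.

(** * Functions vanishing at infinity relative to the weight *)

Section WeightedFunctions.
Context {R : realType} {X : ptopologicalType} (rho : X -> R).
Context (hX : weighted_space rho).
Context (hrho : forall x, 1 <= rho x).
Implicit Types (f g : X -> R).

Lemma weight_gt0 x : 0 < rho x.
Proof. exact: lt_le_trans ltr01 (hrho x). Qed.

Lemma wnorm_le c f : wbound rho c f -> wnorm rho f <= c.
Proof.
move=> h; apply: ge_sup; first by exists ((rho point)^-1 * `|f point|), point.
by move=> _ [x _ <-]; rewrite ler_pdivrMl ?weight_gt0// mulrC; exact: h.
Qed.

Lemma bounded_weightedP f : bounded_weighted rho f <-> exists c, wbound rho c f.
Proof.
split=> [[c hc]|[c hc]]; exists c.
  by move=> x; rewrite mulrC -ler_pdivrMl ?weight_gt0//; apply: hc; exists x.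
by move=> _ [x _ <-]; rewrite ler_pdivrMl ?weight_gt0// mulrC; exact: hc.
Qed.

Lemma wbound_wnorm f : bounded_weighted rho f -> wbound rho (wnorm rho f) f.
Proof.
move=> bf x; rewrite mulrC -ler_pdivrMl ?weight_gt0//.
by apply: sup_upper_bound; [split => //; exists ((rho x)^-1 * `|f x|)|]; exists x.
Qed.

Lemma CbP g : Cb g <-> continuous g /\ exists m, forall x, `|g x| <= m.
Proof.
split=> -[cg bg]; split => //.
  have [m [_ hm]] := bg; exists (m + 1) => x.
  by apply: (hm (m + 1)) => //; rewrite ltrDl.
have [m hm] := bg; exists m; split; first exact: num_real.
by move=> p mp x _; apply: le_trans (hm x) (ltW mp).
Qed.

Lemma wbound_of_bounded m f : (forall x, `|f x| <= m) -> wbound rho m f.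
Proof.
move=> h x; apply: le_trans (h x) _; rewrite ler_peMr//.
by apply: le_trans (h point).
Qed.

(** Differences with functions of [Cb] are bounded relative to [rho], so that
    the supremum in the norm is a true one. *)
Lemma calBP f :
  calB rho f <-> forall e, 0 < e -> exists2 g, Cb g & wbound rho e (fun x => f x -
    g x).
Proof.
have bw c g : Cb g -> wbound rho c (fun x => f x - g x) -> bounded_weighted rho f.
  move=> /CbP[_ [m hm]] hc; apply/bounded_weightedP; exists (c + m) => x.
  have -> : f x = f x - g x + g x by rewrite subrK.
  rewrite (le_trans (ler_normD _ _))// mulrDl; apply: lerD; first exact: hc.
  exact: wbound_of_bounded.
split=> [[bf h] e e0|h]; last first.
  split; first by have [g cg hg] := h 1 ltr01; exact: bw cg hg.
  move=> e e0; have [g cg hg] := h _ (divr_gt0 e0 (ltr0n R 2)); exists g => //.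
  by apply: le_lt_trans (wnorm_le hg) _; lra.
have [g cg hg] := h e e0; exists g => //.
have bfg : bounded_weighted rho (f \- g).
  have [c hc] := (bounded_weightedP f).1 bf; have [_ [m hm]] := (CbP g).1 cg.
  apply/bounded_weightedP; exists (c + m) => x;
    rewrite (le_trans (ler_normB _ _))//.
  by rewrite mulrDl lerD//; exact: wbound_of_bounded.
by apply: wboundW (wbound_wnorm bfg); [exact: weight_gt0|exact: ltW].
Qed.

Lemma calB_bound f : calB rho f -> exists c, wbound rho c f.
Proof. by move=> [/bounded_weightedP]. Qed.

Lemma Cb_lin a f g : Cb f -> Cb g -> Cb (fun x => a * f x + g x).
Proof.
move=> /CbP[cf [m hm]] /CbP[cg [n hn]]; apply/CbP; split.
  move=> x; apply: cvgD; last exact: cg.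
  by apply: cvgM; [exact: cvg_cst|exact: cf].
exists (`|a| * m + n) => x; rewrite (le_trans (ler_normD _ _))// lerD//.
by rewrite normrM ler_wpM2l.
Qed.

Lemma Cb_calB g : Cb g -> calB rho g.
Proof.
move=> cg; apply/calBP => e e0; exists g => // x.
by rewrite subrr normr0 mulr_ge0// ltW// weight_gt0.
Qed.

Lemma Cb_cst (m : R) : Cb (fun _ : X => m).
Proof. by apply/CbP; split; [move=> x; exact: cvg_cst|exists `|m|]. Qed.

Lemma calB_subspace : closed_subspace rho (calB rho).
Proof.
split.
- exact/Cb_calB/Cb_cst.
- move=> a f g /calBP hf /calBP hg; apply/calBP => e e0.
  have a1 : 0 < `|a| + 1 by rewrite ltr_wpDl.
  have [f' cf' hf'] := hf (e / 2 / (`|a| + 1)) (divr_gt0 (divr_gt0 e0 (ltr0n R 2))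
    a1).
  have [g' cg' hg'] := hg _ (divr_gt0 e0 (ltr0n R 2)).
  exists (fun x => a * f' x + g' x); first exact: Cb_lin.
  move=> x; have -> : a * f x + g x - (a * f' x + g' x) = a * (f x - f' x) + (g x -
    g' x) by ring.
  rewrite (le_trans (ler_normD _ _))// normrM.
  have -> : e * rho x = (`|a| + 1) * (e / 2 / (`|a| + 1)) * rho x + e / 2 * rho x.
    by field; rewrite gt_eqF.
  apply: lerD; last exact: hg'.
  by rewrite -mulrA; apply: ler_pM => //; rewrite lerDl.
- exact: calB_bound.
- move=> f h; apply/calBP => e e0.
  have [g /calBP hg fg] := h _ (divr_gt0 e0 (ltr0n R 2)).
  have [g' cg' gg'] := hg _ (divr_gt0 e0 (ltr0n R 2)); exists g' => //.
  apply/wboundP => x; have /wboundP/(_ x)[] := fg; have /wboundP/(_ x)[] := gg'.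
  by move=> *; split; lra.
Qed.

Lemma sublevel_closed r : closed (weight_sublevel rho r).
Proof.
have [hT _ _ hK] := hX.
have [r0|r0] := ltP 0 r; first exact: compact_closed (hK r r0).
rewrite [X in closed X](_ : _ = set0); first exact: closed0.
rewrite -subset0 => x /= xr; have := weight_gt0 x.
by rewrite ltNge (le_trans xr r0).
Qed.

Lemma within_continuousP (A : set X) f : {within A, continuous f} <->
  forall x, A x -> forall e, 0 < e -> \forall y \near x, A y -> `|f x - f y| < e.
Proof.
split=> [/subspace_continuousP h x Ax e e0|h].
  by have /cvgrPdist_lt/(_ e e0) := h x Ax.
by apply/subspace_continuousP => x Ax; apply/cvgrPdist_lt => e e0; exact: h.
Qed.

(** Convergence in the weighted norm is uniform on a sublevel set, where [rho]
    is bounded. *)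
Lemma calB_within f r : calB rho f -> {within weight_sublevel rho r, continuous f}.
Proof.
move=> /calBP hf; apply/within_continuousP => x Kx e e0.
have r0 : 0 < r by apply: lt_le_trans (weight_gt0 x) Kx.
have e3 : 0 < e / 3 by rewrite divr_gt0.
have [g /CbP[cg _] fg] := hf _ (divr_gt0 e3 r0).
have K y : rho y <= r -> `|f y - g y| <= e / 3.
  move=> yr; apply: le_trans (fg y) _; rewrite -mulrA ger_pMr//.
  by rewrite ler_pdivrMl// mulr1.
have := cg x => /cvgrPdist_lt/(_ _ e3); apply: filterS => y gxy Ky.
have := K _ Kx; have := K _ Ky; move: gxy.
rewrite !ltr_norml !ler_norml => /andP[? ?] /andP[? ?] /andP[? ?].
by apply/andP; split; lra.
Qed.

Lemma calB_decay f e : calB rho f -> 0 < e ->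
  exists2 r, 0 < r & forall x, r < rho x -> `|f x| <= e * rho x.
Proof.
move=> /calBP hf e0; have e2 : 0 < e / 2 by rewrite divr_gt0.
have [g /CbP[_ [m hm]] fg] := hf _ e2.
exists (Num.max 1 (m / (e / 2))); first by rewrite lt_max ltr01.
move=> x; rewrite gt_max => /andP[_]; rewrite ltr_pdivrMr// => mx.
have := fg x; have := hm x; rewrite !ler_norml => /andP[? ?] /andP[? ?].
by apply/andP; split; lra.
Qed.

Lemma weighted_space_normal : normal_space X.
Proof.
have [hT cr _ hK] := hX.
apply: (@sigma_compact_normal R X (fun n => weight_sublevel rho n.+1%:R)).
- exact: completely_regular_regular cr.
- by move=> n; exact: hK.
- move=> x; exists (Num.bound (rho x)); rewrite /weight_sublevel /=.
  apply: ltW; apply: lt_trans (archi_boundP (ltW (weight_gt0 x))) _.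
  by rewrite ltr_nat.
Qed.

(** On a sublevel set [K_r] the function is bounded by some [m]; enlarging [r] to
    [s >= 2 m / e], it is bounded on [K_s] by [e s / 2].  A Tietze extension
    from [K_s] with the same bound is then within [e rho] of [f] outside. *)
Lemma calB_intro f :
  (forall r, 0 < r -> {within weight_sublevel rho r, continuous f}) ->
  (forall e, 0 < e -> exists2 r, 0 < r & forall x, r < rho x ->
    `|f x| <= e * rho x) ->
  calB rho f.
Proof.
move=> cf df; apply/calBP => e e0; have e2 : 0 < e / 2 by rewrite divr_gt0.
have [r r0 hr] := df _ e2; have [_ _ _ hK] := hX.
have [m [_ hm]] := compact_bounded (continuous_compact (cf r r0) (hK r r0)).
pose m' := Num.max 1 (m + 1).
have m'0 : 0 < m' by rewrite lt_max ltr01.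
have {}hm x : rho x <= r -> `|f x| <= m'.
  have mm' : m < m' by rewrite lt_max ltrDl ltr01 orbT.
  by move=> xr; have := hm m' mm'; apply; exists x.
(* Beyond [K_s] the extension, bounded by [e s / 2], is below [e rho / 2]. *)
pose s := Num.max r (m' / (e / 2)).
have s0 : 0 < s by rewrite lt_max r0.
have es : 0 < e / 2 * s by rewrite mulr_gt0.
have fs x : rho x <= s -> `|f x| <= e / 2 * s.
  move=> xs; have [xr|xr] := leP (rho x) r.
    apply: le_trans (hm x xr) _; rewrite mulrC -ler_pdivrMr//.
    by rewrite le_max lexx orbT.
  by apply: le_trans (hr x xr) _; rewrite ler_pM2l.
have [g [fg cg gs]] := continuous_bounded_extension (f := f) weighted_space_normal
  (@sublevel_closed s) es (cf s s0) fs.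
exists g; first by apply/CbP; split => //; exists (e / 2 * s).
move=> x; have [xs|xs] := leP (rho x) s.
  by rewrite fg ?inE// subrr normr0 mulr_ge0// ltW// weight_gt0.
have xr : r < rho x by apply: le_lt_trans xs; rewrite le_max lexx.
have := hr x xr; have := gs x.
have : e / 2 * s <= e / 2 * rho x by rewrite ler_pM2l// ltW.
by rewrite !ler_norml => ? /andP[? ?] /andP[? ?]; apply/andP; split; lra.
Qed.

Lemma calB_contraction f h : calB rho f -> (forall x, `|h x| <= `|f x|) ->
  (forall x y, `|h x - h y| <= `|f x - f y|) -> calB rho h.
Proof.
move=> Bf hf hc; apply: calB_intro => [r r0|e e0].
  apply/within_continuousP => x Kx e e0.
  have /within_continuousP/(_ x Kx e e0) := calB_within (r := r) Bf.
  by apply: filterS => y fxy Ky; apply: le_lt_trans (hc x y) (fxy Ky).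
have [r r0 hr] := calB_decay Bf e0; exists r => // x xr.
exact: le_trans (hf x) (hr x xr).
Qed.

(** The weight is the upper envelope of the functions of [calB rho] that it
    dominates; a bound on the operator norm of [P t] therefore turns into a
    bound on [rho] along the flow. *)
Lemma weight_envelope y r : 0 <= r -> r < rho y ->
  exists f, [/\ calB rho f, wbound rho 1 f & f y = r].
Proof.
move=> r0 ry; have [_ cr _ _] := hX.
have nK : ~ weight_sublevel rho r y by apply/negP; rewrite -ltNge.
have /(@uniform_separatorP _ R)[g [cg g01 gy gK]] := cr y _ (@sublevel_closed r) nK.
have {}gy : g y = 0 by apply: gy; exists y.
have g1 x : 0 <= g x <= 1.
  by have : range g (g x) by []; move=> /g01; rewrite /= in_itv.
exists (fun x => r * (1 - g x)); split; last by rewrite gy subr0 mulr1.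
- apply/Cb_calB/CbP; split.
    move=> x; apply: cvgM; first exact: cvg_cst.
    by apply: cvgB; [exact: cvg_cst|exact: cg].
  exists r => x; have /andP[? ?] := g1 x.
  rewrite ger0_norm; first by rewrite ler_piMr//; lra.
  by rewrite mulr_ge0//; lra.
- move=> x; have /andP[? ?] := g1 x; rewrite mul1r ger0_norm; last first.
    by rewrite mulr_ge0//; lra.
  have [xr|xr] := leP (rho x) r.
    have -> : g x = 1 by apply: gK; exists x.
    by rewrite subrr mulr0 ltW// weight_gt0.
  by apply: le_trans (ltW xr); rewrite ler_piMr//; lra.
Qed.

Lemma calB_separates x y : (forall f, calB rho f -> f x = f y) -> x = y.
Proof.
move=> h; apply: contrapT => xy; have [hT cr _ _] := hX.
have c1 : closed [set y] by apply: accessible_closed_set1;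
  exact: hausdorff_accessible.
have /(@uniform_separatorP _ R)[g [cg g01 gx gy]] := cr x _ c1 xy.
have {}gx : g x = 0 by apply: gx; exists x.
have {}gy : g y = 1 by apply: gy; exists y.
suff /h : calB rho g by rewrite gx gy => /esym/eqP; rewrite oner_eq0.
apply/Cb_calB/CbP; split => //; exists 1 => z.
have : range g (g z) by [].
move=> /g01; rewrite /= in_itv /= ler_norml => /andP[? ?].
by apply/andP; split; lra.
Qed.

(** The sets where [f / W] is close to its infimum lie in a single compact
    sublevel set, since [f = o(rho)]; a cluster point of the filter that they
    generate is a minimum because [- W] is upper semicontinuous. *)
Lemma weighted_min f W b : calB rho f -> 0 < b -> (forall x, b * rho x <= W x) ->
  (forall r, closed [set x | W x <= r]) ->
  (forall x, 0 <= f x) \/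
  exists x c, [/\ 0 < c, f x = - (c * W x) & forall y, - (c * W y) <= f y].
Proof.
move=> Bf b0 bW clW.
have W0 x : 0 < W x by apply: lt_le_trans (bW x); rewrite mulr_gt0// weight_gt0.
have [|nf] := pselect (forall x, 0 <= f x); [by left|right].
have /existsNP[z /negP] := nf; rewrite -ltNge => fz.
pose A := range (fun x => - f x / W x).
have ubA : has_ubound A.
  have [c hc] := calB_bound Bf; exists (c / b) => _ [x _ <-].
  rewrite ler_pdivrMr// mulrAC ler_pdivlMr//.
  have := hc x; rewrite ler_norml => /andP[? ?].
  have c0 := wbound_ge0 (weight_gt0 x) hc.
  have : c * (b * rho x) <= c * W x by rewrite ler_wpM2l.
  have : - f x * b <= c * rho x * b by rewrite ler_pM2r//; lra.
  by lra.
have supA : has_sup A by split => //; exists (- f z / W z), z.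
pose c := sup A.
have hc x : - (c * W x) <= f x.
  rewrite lerNl -ler_pdivrMr//; apply: sup_upper_bound => //; by exists x.
have c0 : 0 < c.
  apply: (@lt_le_trans _ _ (- f z / W z)); first by rewrite divr_gt0// oppr_gt0.
  by apply: sup_upper_bound => //; exists z.
have c2 : 0 < c / 2 by rewrite divr_gt0.
pose S e := [set x | f x <= - ((c - e) * W x)].
have cb : 0 < c / 4 * b by rewrite mulr_gt0// divr_gt0.
have [r r0 hr] := calB_decay Bf cb.
have SK e : e <= c / 2 -> S e `<=` weight_sublevel rho r.
  move=> ec x Sx; rewrite /weight_sublevel /= leNgt; apply/negP => xr.
  have := hr x xr; rewrite ler_norml => /andP[h1 _].
  have : c / 2 * W x <= (c - e) * W x by rewrite ler_pM2r//; lra.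
  have : c / 4 * (b * rho x) <= c / 4 * W x by rewrite ler_pM2l// divr_gt0.
  have : 0 < c * W x by rewrite mulr_gt0.
  by move: Sx; rewrite /S /=; lra.
have S0 e : 0 < e -> S e !=set0.
  move=> e0; have [_ [x _ <-] h] := sup_adherent e0 supA; exists x; rewrite /S /=.
  by rewrite lerNr -ler_pdivlMr// ltW.
have SS e e' : e <= e' -> S e `<=` S e'.
  move=> ee x; rewrite /S /= => /le_trans; apply; rewrite lerN2 ler_pM2r//; lra.
pose F := filter_from [set e | 0 < e <= c / 2] S.
have FF : ProperFilter F.
  apply: filter_from_proper => [|e /andP[e0 _]]; last exact: S0.
  apply: filter_from_filter; first by exists (c / 2); rewrite /= c2 lexx.
  move=> e e' /andP[e0 e1] /andP[e0' e1']; exists (Num.min e e').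
    by rewrite /= lt_min e0 e0' ge_min e1.
  by move=> x Sx; split; apply: SS Sx; rewrite ge_min lexx ?orbT.
have [_ _ _ hK] := hX.
have FK : F (weight_sublevel rho r).
  by exists (c / 2); [rewrite /= c2 lexx|apply: SK].
have [x [Kx clx]] := hK r r0 F FF FK.
exists x, c; split => //; apply/eqP; rewrite eq_le hc andbT leNgt; apply/negP => fx.
have [e [e0 ec fe]] : exists e, [/\ 0 < e, e <= c / 2 & - ((c - e) * W x) < f x].
  pose d := (f x + c * W x) / 2; have d0 : 0 < d by rewrite /d; lra.
  exists (Num.min (c / 2) (d / W x)); split; first by rewrite lt_min c2 divr_gt0.
    by rewrite ge_min lexx.
  have : Num.min (c / 2) (d / W x) * W x <= d.
    by rewrite -ler_pdivlMr// ge_min lexx orbT.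
  by rewrite /d; lra.
have ce : 0 < c - e by lra.
(* A level strictly between [- f x / (c - e)] and [W x]: near [x] the weight
   exceeds [s], whereas [f] stays above [- (c - e) s]. *)
pose s := (- f x / (c - e) + W x) / 2.
have sW : s < W x.
  have : - f x / (c - e) < W x by rewrite ltr_pdivrMr//; lra.
  by rewrite /s; lra.
have fs : - ((c - e) * s) < f x.
  have : - f x / (c - e) < s.
    have : - f x / (c - e) < W x by rewrite ltr_pdivrMr//; lra.
    by rewrite /s; lra.
  by rewrite ltr_pdivrMr//; lra.
have n1 : nbhs x (~` [set y | W y <= s]).
  apply: open_nbhs_nbhs; split; first exact/closed_openC/clW.
  by move=> /=; apply/negP; rewrite -ltNge.
have fs' : 0 < f x + (c - e) * s by lra.
have /within_continuousP/(_ x Kx _ fs') n2 := calB_within (r := r) Bf.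
have FS : F (S e) by exists e => //=; rewrite e0 ec.
have [y [Sy [/= Wy fy]]] := clx _ _ FS (filterI n1 n2).
have := fy (SK _ ec _ Sy); rewrite ltr_norml => /andP[_ fxy].
move/negP: Wy; rewrite -ltNge => Wy.
have : (c - e) * s < (c - e) * W y by rewrite ltr_pM2l.
by move: Sy; rewrite /S /=; lra.
Qed.

Lemma lsc_measurable f : (forall r, closed [set x | f x <= r]) ->
  measurable_fun setT (f : borel_type X -> R).
Proof.
move=> clf; apply: (measurability _ (RGenOInfty.measurableE R)).
move=> _ [_ [r ->] <-]; rewrite setTI; apply: sub_sigma_algebra.
rewrite (_ : _ @^-1` _ = ~` [set x | f x <= r]); first exact/closed_openC/clf.
by apply/seteqP; split => x /=; rewrite in_itv /= andbT ltNge => /negP.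
Qed.

Lemma continuous_borel f : continuous f -> measurable_fun setT (f : borel_type X ->
  R).
Proof.
move=> cf; apply: lsc_measurable => r.
rewrite (_ : [set x | _] = f @^-1` [set y | y <= r]) //.
by apply: preimage_closed => //; exact: closed_le.
Qed.

(** A pointwise limit of continuous functions. *)
Lemma calB_measurable f : calB rho f -> measurable_fun setT (f : borel_type X -> R).
Proof.
move=> /calBP hf.
have [g hg] := choice (fun n : nat => let: ex_intro2 g a b :=
  hf n.+1%:R^-1 ltac:(by rewrite invr_gt0) in ex_intro _ g (conj a b)).
apply: (@measurable_fun_cvg _ (borel_type X) R setT g f).
  by move=> n; apply: continuous_borel; have [/CbP[]] := hg n.
move=> x _; apply/cvgrPdist_le => e e0.
near=> n; apply: le_trans ((hg n).2 x) _.
rewrite mulrC ler_pdivrMr// mulrC -ler_pdivrMr//.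
apply: (@le_trans _ _ n%:R); last by rewrite ler_nat.
near: n; exact: nbhs_infty_ger.
Unshelve. all: by end_near. Qed.

End WeightedFunctions.

(** * The jump operator *)

Section JumpOperator.
Context {R : realType} {X : ptopologicalType} (rho : X -> R).
Context (hX : weighted_space rho).
Context (hrho : forall x, 1 <= rho x).
Context (mu : X -> {finite_measure set (borel_type X) -> \bar R}).
Context (M : R).
Context (ha1 : forall x, (\int[mu x]_y (rho y)%:E <= (M * rho x ^+ 2)%:E)%E).
Context (ha3 : forall x, (\int[mu x]_y 1%:E <= (M * Num.sqrt (rho x))%:E)%E).
Implicit Types (f g : X -> R).

Let rho0 x : 0 < rho x := weight_gt0 hrho x.

Lemma weight_integrable x : (mu x).-integrable setT (EFin \o rho).
Proof.
apply/integrableP; split.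
  by apply/measurable_EFinP; apply: lsc_measurable => r;
    exact: sublevel_closed hX hrho _.
apply: le_lt_trans (ltry (M * rho x ^+ 2)); apply: le_trans (ha1 x).
apply: ge0_le_integral => //=.
- apply/measurable_EFinP; apply: measurableT_comp => //.
  by apply: lsc_measurable => r; exact: sublevel_closed hX hrho _.
- by apply/measurable_EFinP; apply: lsc_measurable => r;
  exact: sublevel_closed hX hrho _.
- by move=> y _; rewrite lee_fin gtr0_norm.
Qed.

Lemma calB_integrable f x : calB rho f -> (mu x).-integrable setT (EFin \o f).
Proof.
move=> Bf; have [c hc] := calB_bound hrho Bf.
have : (mu x).-integrable setT (fun y => c%:E * (EFin \o rho) y)%E.
  by apply: integrableZl => //; exact: weight_integrable.
apply: le_integrable => //.
  by have mf := calB_measurable hrho Bf; exact/measurable_EFinP.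
move=> y _ /=; rewrite lee_fin; apply: le_trans (hc y) _; exact: ler_norm.
Qed.

Lemma cst_integrable x (k : R) : (mu x).-integrable setT (EFin \o (fun=> k)).
Proof. exact: finite_measure_integrable_cst. Qed.

Lemma integrable_shift f x : calB rho f ->
  (mu x).-integrable setT (EFin \o (fun y => f y - f x)).
Proof.
move=> Bf.
have H := integrableB measurableT (calB_integrable x Bf) (cst_integrable x (f x)).
exact: eq_integrable H.
Qed.

Definition jump_rate x : R := fine (mu x setT).

Lemma jump_rate_ge0 x : 0 <= jump_rate x.
Proof. by rewrite fine_ge0. Qed.

Lemma jump_rate_le x : jump_rate x <= M * Num.sqrt (rho x).
Proof.
have := ha3 x; rewrite integral_cst// mul1e -lee_fin; apply: le_trans.
by rewrite /jump_rate fineK// fin_num_measure.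
Qed.

Lemma jumpE f x : calB rho f ->
  jump_operator mu f x = \int[mu x]_y f y - f x * jump_rate x.
Proof.
move=> Bf; rewrite /jump_operator RintegralB//; first by rewrite Rintegral_cst.
- exact: calB_integrable.
- exact: cst_integrable.
Qed.

Lemma jump_linear a f g : calB rho f -> calB rho g ->
  jump_operator mu (fun x => a * f x + g x) =
  (fun x => a * jump_operator mu f x + jump_operator mu g x).
Proof.
move=> Bf Bg; apply/funext => x.
rewrite !jumpE//; last exact: (subspace_lin (calB_subspace hrho)).
rewrite RintegralD//; last 2 first.
- by have := calB_integrable x (subspaceZ (calB_subspace hrho) a Bf).
- exact: calB_integrable.
by rewrite RintegralZl//; [ring|exact: calB_integrable].
Qed.

(** For the shift [c], the operator [B + c] is the integral against [mu x] plus
    the multiplication by [c - jump_rate x], which cancels the negative part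
    of [B] where the rate is at most [c]. *)
Lemma jump_bound f m c x : calB rho f -> (forall y, `|f y| <= m) ->
  `|jump_operator mu f x + c * f x| <= m * (jump_rate x + `|c - jump_rate x|).
Proof.
move=> Bf hm; rewrite jumpE//.
rewrite [X in `|X|](_ : _ = \int[mu x]_y f y + (c - jump_rate x) * f x);
  last by ring.
rewrite (le_trans (ler_normD _ _))// mulrDr; apply: lerD; last first.
  by rewrite normrM mulrC ler_wpM2r.
rewrite (le_trans (le_normr_Rintegral _ (calB_integrable x Bf)))//.
rewrite -[leRHS](_ : \int[mu x]_y m = _); last by rewrite Rintegral_cst.
apply: le_Rintegral => //; last exact: cst_integrable.
by have := integrable_norm (calB_integrable x Bf).
Qed.

Lemma jump_growth_ge0 (y : X) : 0 <= M.
Proof.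
have := le_trans (jump_rate_ge0 y) (jump_rate_le y).
by rewrite pmulr_lge0// sqrtr_gt0.
Qed.

Context (hB : forall f, calB rho f -> forall r, 0 <= r ->
  {within weight_sublevel rho r, continuous (jump_operator mu f)}).

(** For bounded [f], [B f] is of order [sqrt rho], hence negligible relative to
    [rho] at infinity. *)
Lemma jump_calB f m : calB rho f -> (forall y, `|f y| <= m) ->
  calB rho (jump_operator mu f).
Proof.
move=> Bf hm; apply: (calB_intro hX hrho) => [r r0|e e0].
  by apply: hB => //; exact: ltW.
have m0 : 0 <= m by apply: le_trans (hm point).
have M0 := jump_growth_ge0 point.
pose K := 2 * m * M / e + 1.
have K0 : 0 < K by rewrite ltr_wpDl// divr_ge0 ?mulr_ge0// ltW.
exists (K ^+ 2); first by rewrite exprn_gt0.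
move=> x xK; have := jump_bound 0 x Bf hm.
rewrite mul0r addr0 sub0r normrN (ger0_norm (jump_rate_ge0 x)) => /le_trans; apply.
have sK : K < Num.sqrt (rho x).
  by rewrite -[K]gtr0_norm// -sqrtr_sqr ltr_sqrt.
have s0 : 0 < Num.sqrt (rho x) := lt_trans K0 sK.
rewrite -[in leRHS](sqr_sqrtr (ltW (rho0 x))).
apply: (@le_trans _ _ (2 * m * M * Num.sqrt (rho x))).
  have : m * jump_rate x <= m * (M * Num.sqrt (rho x)).
    by rewrite ler_wpM2l// jump_rate_le.
  by lra.
rewrite expr2 mulrA ler_pM2r// -ler_pdivrMl// mulrC.
by apply: ltW; apply: le_lt_trans sK; rewrite /K lerDl.
Qed.

(** Where the rate exceeds [c], it is at most [rate^2 / c <= M^2 rho / c]. *)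
Lemma jump_bound_excess f m c x : 0 < c -> calB rho f -> (forall y, `|f y| <= m) ->
  `|jump_operator mu f x + c * f x| <= c * m + 2 * M ^+ 2 * m / c * rho x.
Proof.
move=> c0 Bf hm; apply: le_trans (jump_bound c x Bf hm) _.
have m0 : 0 <= m by apply: le_trans (hm point).
have M0 := jump_growth_ge0 x.
have L0 := jump_rate_ge0 x; have L1 := jump_rate_le x.
set L := jump_rate x in L0 L1 *.
have r0 : 0 <= 2 * M ^+ 2 * m / c * rho x.
  by rewrite !mulr_ge0 ?invr_ge0 ?sqr_ge0// ltW.
have [Lc|cL] := leP L c.
  by rewrite ger0_norm ?subr_ge0//; lra.
rewrite ler0_norm; last by lra.
have L2 : L ^+ 2 <= M ^+ 2 * rho x.
  rewrite -(sqr_sqrtr (ltW (rho0 x))) -exprMn ler_sqr ?nnegrE//.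
  exact: le_trans L1.
have : L * c <= M ^+ 2 * rho x.
  by apply: le_trans L2; rewrite expr2 ler_wpM2l// ltW.
rewrite -ler_pdivlMr// => L3.
have : m * L <= m * (M ^+ 2 * rho x / c) by rewrite ler_wpM2l.
have : 0 <= m * c by rewrite mulr_ge0// ltW.
by lra.
Qed.

(** At a minimum [x] of [f / W] one has [f y - f x >= - c (W y - W x)], to be
    integrated against [mu x]. *)
Lemma jump_at_min f W c omega' x : 0 <= c -> calB rho f -> 0 < W x ->
  (forall r, closed [set y | W y <= r]) ->
  (\int[mu x]_y (`|(W y - W x) / W x|)%:E <= omega'%:E)%E ->
  f x = - (c * W x) -> (forall y, - (c * W y) <= f y) ->
  - (c * omega' * W x) <= jump_operator mu f x.
Proof.
move=> c0 Bf Wx clW hb fx fy.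
pose h y := `|(W y - W x) / W x|.
have mh : measurable_fun setT (h : borel_type X -> R).
  apply: measurableT_comp => //; apply: measurable_funM => //.
  by apply: measurable_funB => //; exact: lsc_measurable.
have ih : (mu x).-integrable setT (EFin \o h).
  apply/integrableP; split; first exact/measurable_EFinP.
  apply: le_lt_trans (ltry omega'); apply: le_trans hb.
  apply: ge0_le_integral => //=.
  - by apply/measurable_EFinP; apply: measurableT_comp.
  - exact/measurable_EFinP.
  - by move=> y _; rewrite lee_fin normr_id.
have hle : \int[mu x]_y h y <= omega'.
  by rewrite -lee_fin fineK//; exact: integrable_fin_num.
have icW : (mu x).-integrable setT (EFin \o (fun y => - (c * W x) * h y)).
  by have := integrableZl measurableT (- (c * W x)) ih.
apply: (@le_trans _ _ (\int[mu x]_y (- (c * W x) * h y))).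
  rewrite RintegralZl//; have : c * W x * \int[mu x]_y h y <= c * W x * omega'.
    by rewrite ler_wpM2l// mulr_ge0// ltW.
  by lra.
apply: le_Rintegral => //; first exact: integrable_shift.
move=> y _; rewrite fx opprK mulNr.
have -> : c * W x * h y = c * `|W y - W x|.
  by rewrite /h normrM normfV (gtr0_norm Wx); field; rewrite gt_eqF.
have : c * (W y - W x) <= c * `|W y - W x| by rewrite ler_wpM2l// ler_norm.
by have := fy y; lra.
Qed.

End JumpOperator.

(** * Generators in equivalent weights, and the transport semigroup *)

Section Generators.
Context {R : realType} {X : ptopologicalType}.
Implicit Types (w rho f g : X -> R).

Lemma wnorm_ge0 rho f : (forall x, 1 <= rho x) -> bounded_weighted rho f ->
  0 <= wnorm rho f.
Proof.
move=> hrho bf; have := wbound_wnorm hrho bf.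
by apply: wbound_ge0; exact: (weight_gt0 hrho point).
Qed.

Lemma generator_graphP rho P f g : (forall x, 1 <= rho x) ->
  (forall t h, 0 <= t -> calB rho h -> calB rho (P t h)) ->
  generator_graph rho P (f, g) <-> gen rho (calB rho) P f g.
Proof.
move=> hrho PE; have hE := calB_subspace hrho.
have Bq t : 0 < t -> calB rho f -> calB rho g ->
    bounded_weighted rho (fun x => (P t f x - f x) / t - g x).
  move=> t0 Bf Bg.
  have : calB rho (fun x => t^-1 * (P t f x - f x) - g x).
    by apply: (subspaceB hE) => //; apply: (subspaceZ hE);
      apply: (subspaceB hE) => //; apply: PE => //; exact: ltW.
  by move=> [+ _]; congr (bounded_weighted rho); apply/funext => x; rewrite mulrC.
split=> [[/= Bf Bg /cvgrPdist_le h]|[Bf Bg h]]; split => //.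
  move=> e e0; have [d /= d0 hd] := h _ e0; exists d => // t /andP[t0 td].
  have /(_ _)/wrap[] := hd t; first by rewrite /ball /= sub0r normrN gtr0_norm.
  move=> /(_ t0); rewrite sub0r normrN => /(le_trans (ler_norm _)) nt x.
  have -> : P t f x - f x - t * g x = t * ((P t f x - f x) / t - g x).
    by field; rewrite gt_eqF.
  rewrite normrM gtr0_norm// [e * t]mulrC -mulrA ler_pM2l//.
  apply: le_trans (wbound_wnorm hrho (Bq t t0 Bf Bg) x) _.
  by rewrite ler_pM2r// (weight_gt0 hrho).
apply/cvgrPdist_le => e e0; have [d d0 hd] := h _ e0; exists d => //= t.
rewrite /ball /= sub0r normrN => td t0; rewrite gtr0_norm// in td.
rewrite sub0r normrN ger0_norm; last by apply: wnorm_ge0 => //; exact: Bq.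
apply: (wnorm_le hrho) => x; have := hd t _ x; rewrite t0 td => /(_ isT) H.
rewrite -(ler_pM2l t0) -{1}(gtr0_norm t0) -normrM mulrA [t * e]mulrC.
rewrite [X in `|X|](_ : _ = P t f x - f x - t * g x)//.
by field; rewrite gt_eqF.
Qed.

Lemma wbound_trans w w' K c f : 0 <= c -> (forall x, w x <= K * w' x) ->
  wbound w c f -> wbound w' (c * K) f.
Proof.
move=> c0 ww h x; apply: le_trans (h x) _.
by rewrite -mulrA ler_wpM2l.
Qed.

Lemma subspace_equiv w w' K E : (forall x, 0 < w x) -> 0 < K ->
  (forall x, w x <= w' x) -> (forall x, w' x <= K * w x) ->
  closed_subspace w E -> closed_subspace w' E.
Proof.
move=> w0 K0 ww ww' hE; split.
- exact: subspace0 hE.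
- exact: subspace_lin hE.
- move=> f /(subspace_bound hE)[c hc]; exists (`|c| * 1).
  apply: (wbound_trans (w := w)) => //; first by move=> x; rewrite mul1r.
  by move=> x; apply: le_trans (hc x) _; rewrite ler_pM2r// ler_norm.
- move=> f h; apply: (subspace_closed hE) => e e0.
  have [g Eg hg] := h _ (divr_gt0 e0 K0); exists g => //.
  have := wbound_trans (ltW (divr_gt0 e0 K0)) ww' hg.
  by rewrite mulfVK// gt_eqF.
Qed.

Lemma gen_equiv_weight w w' K E S f g : 0 < K ->
  (forall x, w x <= w' x) -> (forall x, w' x <= K * w x) ->
  gen w E S f g <-> gen w' E S f g.
Proof.
move=> K0 ww ww'; split=> -[Ef Eg h]; split => // e e0.
  have [d d0 hd] := h _ e0; exists d => // t td; rewrite -[e * t]mulr1.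
  have /andP[t0 _] := td.
  apply: (wbound_trans (w := w)); [|by move=> x; rewrite mul1r|exact: hd].
  by rewrite mulr_ge0// ltW.
have [d d0 hd] := h _ (divr_gt0 e0 K0); exists d => // t td.
have /andP[t0 _] := td.
have := wbound_trans (ltW (mulr_gt0 (divr_gt0 e0 K0) t0)) ww' (hd t td).
by rewrite mulrAC mulfVK// gt_eqF.
Qed.

Lemma expR_second_order (s : R) : `|s| <= 1/2 -> `|expR s - 1 - s| <= 2 * s ^+ 2.
Proof.
move=> hs; have h1 := expR_ge1Dx s; rewrite ger0_norm; last by lra.
move: hs; rewrite ler_norml => /andP[s1 s2].
have h2 : 1 - s <= expR (- s) by have := expR_ge1Dx (- s).
have h3 : expR s * expR (- s) = 1 by rewrite -expRD subrr expR0.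
have p := expR_gt0 s.
have h4 : expR s * (1 - s) <= 1 by rewrite -[leRHS]h3 ler_pM2l.
have h5 : 0 < 1 - s by lra.
rewrite -(ler_pM2r h5).
have : 0 <= s ^+ 2 * (1 - 2 * s) by rewrite mulr_ge0 ?sqr_ge0//; lra.
by rewrite expr2; lra.
Qed.

(** The factor [exp (a t)] only contributes its derivative [a] at [0], because
    [exp (a t) - 1 - a t] is quadratic in [t]. *)
Lemma gen_rescale w E P a f g : (forall x, 0 < w x) -> closed_subspace w E ->
  gen w E P f g ->
  gen w E (fun t h x => expR (a * t) * P t h x) f (fun x => g x + a * f x).
Proof.
move=> w0 hE [Ef Eg h]; split => //; first exact: (subspaceD hE Eg (subspaceZ hE a
  Ef)).
have [m [m0 hm _]] := wbound_least w0 (subspace_bound hE Ef).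
have [n [n0 hn _]] := wbound_least w0 (subspace_bound hE Eg).
move=> e e0; have e4 : 0 < e / 4 by rewrite divr_gt0.
have [d d0 hd] := h _ e4.
pose b := `|a| + 1; have b0 : 0 < b by rewrite ltr_wpDl.
(* [2 K t^2] bounds the two terms due to the exponential factor, [n] and [m]
   being the norms of [g] and [f]. *)
pose K := b * n + b ^+ 2 * m + 1.
have K0 : 0 < K by rewrite ltr_wpDl// addr_ge0// mulr_ge0// ?ltW// exprn_gt0.
exists (Num.min d (Num.min (1 / 2 / b) (e / 4 / K))).
  by rewrite !lt_min d0 !divr_gt0.
move=> t /andP[t0]; rewrite !lt_min => /and3P[td tb tK].
rewrite !ltr_pdivlMr// in tb tK.
pose s := a * t.
have sb : `|s| <= b * t by rewrite /s normrM (gtr0_norm t0) ler_pM2r// lerDl.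
have s12 : `|s| <= 1 / 2 by lra.
have s2 : s ^+ 2 <= b ^+ 2 * t * t.
  rewrite -real_normK ?num_real// (_ : b ^+ 2 * t * t = (b * t) ^+ 2); last by ring.
  by rewrite ler_sqr ?nnegrE// mulr_ge0// ltW.
have E1 := expR_second_order s12.
have E2 : `|expR s - 1| <= 2 * (b * t).
  have -> : expR s - 1 = expR s - 1 - s + s by ring.
  apply: le_trans (ler_normD _ _) _.
  have : 2 * s ^+ 2 <= `|s|.
    rewrite -real_normK ?num_real// expr2 mulrA ler_piMl//; lra.
  by lra.
have E3 : 0 <= expR s <= 2.
  by rewrite expR_ge0 /=; move: E2; rewrite ler_norml => /andP[_]; lra.
move=> x.
have -> : expR (a * t) * P t f x - f x - t * (g x + a * f x) =
  expR s * (P t f x - f x - t * g x) + (expR s - 1) * (t * g x) + (expR s - 1 - s)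
    * f x.
  by rewrite /s; ring.
apply: le_trans (ler_normD _ _) _; apply: le_trans (lerD (ler_normD _ _) (lexx _))
  _.
rewrite !normrM (gtr0_norm t0) (ger0_norm (expR_ge0 s)).
have H1 : expR s * `|P t f x - f x - t * g x| <= 2 * (e / 4 * t * w x).
  by apply: ler_pM => //; [case/andP: E3|apply: hd; rewrite t0].
have H2 : `|expR s - 1| * (t * `|g x|) <= 2 * (b * t) * (t * (n * w x)).
  by apply: ler_pM => //; [rewrite mulr_ge0// ltW|rewrite ler_pM2l].
have H3 : `|expR s - 1 - s| * `|f x| <= 2 * (b ^+ 2 * t * t) * (m * w x).
  by apply: ler_pM => //; lra.
have H4 : t * K * (2 * t * w x) <= e / 4 * (2 * t * w x).
  by apply: ler_wpM2r; [rewrite !mulr_ge0// ltW|lra].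
have H5 : 0 < 2 * t * t * w x by rewrite !mulr_gt0.
by rewrite /K in H4; lra.
Qed.

End Generators.

Section Transport.
Context {R : realType} {X : ptopologicalType} (rho : X -> R).
Context (hX : weighted_space rho).
Context (hrho : forall x, 1 <= rho x).
Context (P : R -> (X -> R) -> (X -> R)).
Context (hP : generalized_feller_semigroup rho P).
Context (psi : R -> X -> X).
Context (hpsi : transport_type rho P psi).
Context (M1 omega : R).
Context (hbound : forall t, 0 <= t -> opnorm rho (P t) <= M1 * expR (omega * t)).
Implicit Types (f g : X -> R).

Lemma opnorm_bound t f : 0 <= t -> calB rho f -> wbound rho 1 f ->
  wbound rho (M1 * expR (omega * t)) (P t f).
Proof.
move=> t0 Bf hf; have [PE _ ub] := gf_bounded hP t0.
have [bPf _] := PE f Bf.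
have inS : unit_ball_image rho (P t) (wnorm rho (P t f)).
  by exists f => //; split => //; exact: (wnorm_le hrho hf).
apply: wboundW (wbound_wnorm hrho bPf); first exact: weight_gt0.
apply: le_trans (hbound t0); apply: sup_upper_bound => //.
by split => //; exists (wnorm rho (P t f)).
Qed.

(** The bound on the operator norm, tested on the functions of
    [weight_envelope]. *)
Lemma weight_transport t x : 0 <= t ->
  rho (psi t x) <= M1 * expR (omega * t) * rho x.
Proof.
move=> t0; rewrite leNgt; apply/negP => lt.
pose r := Num.max 0 (M1 * expR (omega * t) * rho x).
pose s := (r + rho (psi t x)) / 2.
have r0 : 0 <= r by rewrite le_max lexx.
have rr : r < rho (psi t x) by rewrite gt_max lt (weight_gt0 hrho).
have s0 : 0 <= s by rewrite /s; have := weight_gt0 hrho (psi t x); lra.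
have ss : s < rho (psi t x) by rewrite /s; lra.
have [f [Bf hf fs]] := weight_envelope hX hrho s0 ss.
have := opnorm_bound t0 Bf hf x; rewrite (hpsi.2 t t0 f Bf) /= fs ger0_norm//.
have : M1 * expR (omega * t) * rho x <= r by rewrite le_max lexx orbT.
by rewrite /s; lra.
Qed.

Lemma transport_id x : psi 0 x = x.
Proof.
apply: (calB_separates hX hrho) => f Bf.
by rewrite -[in RHS](gf_id hP Bf) (hpsi.2 _ (lexx 0) f Bf).
Qed.

(** The functions of [calB rho] separate points, so the semigroup law of [P]
    passes to the flow. *)
Lemma transport_comp s t x : 0 <= s -> 0 <= t -> psi s (psi t x) = psi (t + s) x.
Proof.
move=> s0 t0; apply: (calB_separates hX hrho) => f Bf.
have := gf_semigroup hP t0 s0 Bf.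
have [PE _ _] := gf_bounded hP s0.
rewrite (hpsi.2 _ (addr_ge0 t0 s0) f Bf) (hpsi.2 t t0 _ (PE f Bf)) (hpsi.2 s s0 f
  Bf).
by move=> /(congr1 (fun F => F x)) /= ->.
Qed.

Notation rt := (sup_weight rho psi omega).

Let rt_set x := [set expR (- omega * t) * rho (psi t x) | t in [set t | 0 <= t]].

Lemma sup_weight_has_sup x : has_sup (rt_set x).
Proof.
split; first by exists (expR (- omega * 0) * rho (psi 0 x)), 0; rewrite /=.
exists (M1 * rho x) => _ [t t0 <-].
have := weight_transport x t0; rewrite -(ler_pM2l (expR_gt0 (- omega * t))).
move=> /le_trans; apply.
rewrite [leLHS](_ : _ = expR (- omega * t) * expR (omega * t) * (M1 * rho x));
  last by ring.
by rewrite -expRD mulNr addNr expR0 mul1r.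
Qed.

Lemma sup_weight_ge t x : 0 <= t -> expR (- omega * t) * rho (psi t x) <= rt x.
Proof. by move=> t0; apply: sup_upper_bound;
  [exact: sup_weight_has_sup|exists t]. Qed.

Lemma sup_weight_le x c : (forall t, 0 <= t ->
  expR (- omega * t) * rho (psi t x) <= c) ->
  rt x <= c.
Proof.
move=> h; apply: ge_sup; first by have [] := sup_weight_has_sup x.
by move=> _ [t t0 <-]; exact: h.
Qed.

Lemma weight_le_sup_weight x : rho x <= rt x.
Proof.
by have := sup_weight_ge x (lexx 0); rewrite mulr0 expR0 mul1r transport_id.
Qed.

Lemma sup_weight_le_weight x : rt x <= M1 * rho x.
Proof.
apply: sup_weight_le => t t0.
have := weight_transport x t0; rewrite -(ler_pM2l (expR_gt0 (- omega * t))).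
move=> /le_trans; apply.
rewrite [leLHS](_ : _ = expR (- omega * t) * expR (omega * t) * (M1 * rho x));
  last by ring.
by rewrite -expRD mulNr addNr expR0 mul1r.
Qed.

(** This is what [rt] is for: its growth along the flow is bounded with the
    constant [1] instead of [M1]. *)
Lemma sup_weight_transport t x : 0 <= t -> rt (psi t x) <= expR (omega * t) * rt x.
Proof.
move=> t0; apply: sup_weight_le => s s0; rewrite transport_comp//.
have := sup_weight_ge x (addr_ge0 t0 s0).
rewrite -(ler_pM2l (expR_gt0 (omega * t))) mulrA -expRD.
by rewrite (_ : omega * t + - omega * (t + s) = - omega * s)//; ring.
Qed.

Lemma sup_weight_lsc r : closed [set x | rt x <= r].
Proof.
rewrite (_ : [set x | _] = \bigcap_(t in [set t | 0 <= t])
  (psi t @^-1` weight_sublevel rho (expR (omega * t) * r))).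
  apply: closed_bigI => t t0; apply: preimage_closed;
    last exact: sublevel_closed hX hrho _.
  by move=> x _; exact: (hpsi.1 t t0).
apply/seteqP; split=> x /= h.
  move=> t t0; rewrite /weight_sublevel /=.
  have := le_trans (sup_weight_ge x t0) h.
  rewrite -(ler_pM2l (expR_gt0 (omega * t))) mulrA -expRD.
  by rewrite mulNr subrr expR0 mul1r.
apply: sup_weight_le => t t0; have := h t t0; rewrite /weight_sublevel /=.
rewrite -(ler_pM2l (expR_gt0 (- omega * t))) mulrA -expRD.
by rewrite mulNr addNr expR0 mul1r.
Qed.

Lemma transport_bound_gt0 : 0 < M1.
Proof.
have := le_trans (weight_le_sup_weight point) (sup_weight_le_weight point).
have p := weight_gt0 hrho point.
by rewrite -(pmulr_lgt0 M1 p); apply: lt_le_trans.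
Qed.

(** Since [rho >= 1], the weight cannot decay along the flow. *)
Lemma transport_growth_ge0 : 0 <= omega.
Proof.
rewrite leNgt; apply/negP => w0.
pose x : X := point; pose K := M1 * rho x.
have K0 : 0 < K by rewrite mulr_gt0 ?transport_bound_gt0// (weight_gt0 hrho).
pose t := K / - omega.
have t0 : 0 <= t by rewrite divr_ge0 ?ltW// oppr_gt0.
have := weight_transport x t0; have := hrho (psi t x) => h1 h2.
have : 1 <= expR (omega * t) * K.
  by apply: le_trans h1 (le_trans h2 _); rewrite /K mulrA [_ * M1]mulrC.
rewrite -(ler_pM2l (expR_gt0 (- (omega * t)))).
rewrite [expR _ * (expR _ * _)]mulrA -expRD addNr expR0 mulr1 mul1r.
have := expR_ge1Dx (- (omega * t)).
have -> : - (omega * t) = K by rewrite /t; field; rewrite lt_eqF.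
by lra.
Qed.

Let rho0 x : 0 < rho x := weight_gt0 hrho x.

Lemma sup_weight_gt0 x : 0 < rt x.
Proof. exact: lt_le_trans (rho0 x) (weight_le_sup_weight x). Qed.

Lemma calB_sup_weight_subspace : closed_subspace rt (calB rho).
Proof.
apply: (subspace_equiv rho0 transport_bound_gt0) (calB_subspace hrho).
- exact: weight_le_sup_weight.
- exact: sup_weight_le_weight.
Qed.

Lemma semigroup_calB t f : 0 <= t -> calB rho f -> calB rho (P t f).
Proof. by move=> t0 Bf; have [PE _ _] := gf_bounded hP t0; exact: PE. Qed.

(** Along the flow, [f (psi_t x) >= - c (a + b exp (omega t) rt x)]; divide the
    increment from [t = 0] by [t].  The constant [a] is there for the supremum
    norm estimate of the resolvent. *)
Lemma gen_at_min f g a b c x : gen rho (calB rho) P f g ->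
  0 <= b -> 0 <= c ->
  f x = - (c * (a + b * rt x)) -> (forall y, - (c * (a + b * rt y)) <= f y) ->
  - (c * (b * omega * rt x)) <= g x.
Proof.
move=> [Bf Bg h] b0 c0 fx fy.
have cb0 : 0 <= c * b by rewrite mulr_ge0.
have p := sup_weight_gt0 x; have q := rho0 x.
suff H e : 0 < e -> - (c * (b * omega * rt x)) <= g x + e * (rho x + 2 * c * b * rt
  x).
  have K0 : 0 < rho x + 2 * c * b * rt x.
    by rewrite ltr_pwDl// !mulr_ge0// ltW.
  apply/ler_addgt0Pr => e e0; have := H _ (divr_gt0 e0 K0).
  by rewrite mulfVK// gt_eqF.
move=> e0; have [d d0 hd] := h _ e0.
(* [t o <= min (1/2) e] makes [omega t] small enough for [expR_second_order]
   and its quadratic remainder at most [2 e t]. *)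
pose o := omega ^+ 2 + 1 + 2 * omega.
have w0 := transport_growth_ge0.
have o0 : 0 < o by rewrite /o; have := sqr_ge0 omega; lra.
pose t := Num.min (d / 2) (Num.min (1 / 2 / o) (e / o)).
have t0 : 0 < t by rewrite !lt_min !divr_gt0.
have td : t < d by rewrite gt_min; apply/orP; left; lra.
have to1 : t * o <= 1 / 2 by rewrite -ler_pdivlMr// !ge_min lexx !orbT.
have to2 : t * o <= e by rewrite -ler_pdivlMr// !ge_min lexx !orbT.
have hs : `|omega * t| <= 1 / 2.
  rewrite ger0_norm; last by rewrite mulr_ge0// ltW.
  have : 0 <= (omega ^+ 2 + 1 + omega) * t.
    by rewrite mulr_ge0 ?ltW//; have := sqr_ge0 omega; lra.
  by rewrite /o in to1; lra.
have := expR_second_order hs; rewrite ler_norml => /andP[_ E1].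
have E2 : expR (omega * t) - 1 <= omega * t + 2 * e * t.
  have : t * t * omega ^+ 2 <= t * e.
    rewrite -mulrA ler_pM2l//; apply: le_trans to2.
    by rewrite ler_pM2l// /o; lra.
  by rewrite exprMn in E1; rewrite -expr2 in E1 *; lra.
have := hd t _ x; rewrite t0 td => /(_ isT); rewrite (hpsi.2 t (ltW t0) f Bf) /= fx.
rewrite ler_norml => /andP[_ H1].
have H2 := fy (psi t x).
have H3 : c * b * rt (psi t x) <= c * b * (expR (omega * t) * rt x).
  by rewrite ler_wpM2l// sup_weight_transport// ltW.
have H4 : c * b * ((expR (omega * t) - 1) * rt x) <= c * b * ((omega * t + 2 * e *
  t) * rt x).
  by rewrite ler_wpM2l// ler_wpM2r// ltW.
rewrite -(ler_pM2l t0).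
by lra.
Qed.

Lemma transport_strongly_continuous (Pd : dense_domain rho (calB rho) (gen rho
  (calB rho) P)) f :
  calB rho f -> forall e, 0 < e -> exists2 d, 0 < d &
    forall t, 0 <= t < d -> wbound rt e (fun x => P t f x - f x).
Proof.
move=> Bf e e0; have M0 := transport_bound_gt0; have hE := calB_subspace hrho.
have e8 : 0 < e / (8 * M1) by rewrite divr_gt0// mulr_gt0.
have [f' [g' [gf' ff']]] := Pd _ Bf _ e8.
have [Bf' Bg' h] := gf'.
have [m [m0 hm _]] := wbound_least rho0 (subspace_bound hE Bg').
have [d d0 hd] := h _ ltr01.
have w0 := transport_growth_ge0.
have m1 : 0 < 4 * (m + 1) by rewrite mulr_gt0// ltr_wpDl.
have w1 : 0 < 4 * (omega + 1) by rewrite mulr_gt0// ltr_wpDl.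
exists (Num.min d (Num.min (e / (4 * (m + 1))) (1 / (4 * (omega + 1))))).
  by rewrite !lt_min d0 !divr_gt0.
move=> t /andP[t0]; rewrite !lt_min => /and3P[td tm tw].
rewrite !ltr_pdivlMr// in tm tw.
have wt : `|omega * t| <= 1 / 2 by rewrite ger0_norm ?mulr_ge0//; lra.
have := expR_second_order wt; rewrite ler_norml => /andP[_ E1].
have E2 : expR (omega * t) <= 2.
  have : (omega * t) ^+ 2 <= (1 / 2) ^+ 2.
    by rewrite ler_sqr ?nnegrE ?mulr_ge0//; lra.
  have : omega * t <= 1 / 2 by lra.
  by lra.
have H0 : wbound rt (e / 4) (fun x => P t f' x - f' x).
  have [t00|t00] := eqVneq t 0.
    move=> x; rewrite t00 (gf_id hP Bf') subrr normr0 mulr_ge0 ?ltW//.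
      by rewrite divr_gt0.
    exact: sup_weight_gt0.
  have tp : 0 < t by rewrite lt_neqAle eq_sym t00.
  have H := hd t; rewrite tp td in H; have {}H := H isT.
  apply/wboundP => x; have /wboundP/(_ x)[] := H; have [] := wboundZ x t0 hm.
  have : t * (m + 1) * rho x <= e / 4 * rho x by rewrite ler_pM2r//; lra.
  have : e / 4 * rho x <= e / 4 * rt x by rewrite ler_pM2l ?weight_le_sup_weight//
    divr_gt0.
  by move=> *; split; lra.
move=> x.
have fB := hpsi.2 t t0 f Bf; have fB' := hpsi.2 t t0 f' Bf'.
have -> : P t f x - f x = (f (psi t x) - f' (psi t x)) + (P t f' x - f' x) - (f x -
  f' x).
  by rewrite fB fB' /=; ring.
have A1 := ff' (psi t x); have A2 := ff' x; have A3 := H0 x.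
apply: le_trans (ler_normB _ _) _; apply: le_trans (lerD (ler_normD _ _) (lexx _))
  _.
apply: le_trans (lerD (lerD A1 A3) A2) _.
have B1 : e / (8 * M1) * rho (psi t x) <= e / (8 * M1) * (M1 * 2 * rho x).
  rewrite ler_pM2l//; apply: le_trans (weight_transport x t0) _.
  by rewrite ler_pM2r// ler_pM2l.
have B2 : e / (8 * M1) * (M1 * 2 * rho x) = e / 4 * rho x by field; rewrite gt_eqF.
have B3 : e / 4 * rho x <= e / 4 * rt x by rewrite ler_pM2l ?weight_le_sup_weight//
  divr_gt0.
have B4 : e / (8 * M1) * rho x <= e / 8 * rt x.
  rewrite (_ : e / (8 * M1) * rho x = e / 8 * (rho x / M1)); last first.
    by field; rewrite gt_eqF.
  rewrite ler_pM2l ?divr_gt0//; apply: le_trans (weight_le_sup_weight x).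
  rewrite ler_pdivrMr// ler_peMr ?(ltW (rho0 x))//.
  have := le_trans (weight_le_sup_weight point) (sup_weight_le_weight point).
  by rewrite ler_pMl.
have B5 : 0 < e * rt x by rewrite mulr_gt0// sup_weight_gt0.
by lra.
Qed.

(** The damping factor turns [P] into a contraction semigroup in the weight
    [rt]. *)
Definition damped (t : R) f : X -> R := fun x => expR (- omega * t) * P t f x.

Lemma damped_contraction :
  dense_domain rho (calB rho) (gen rho (calB rho) P) ->
  contraction_semigroup rt (calB rho) damped.
Proof.
move=> Pd; have hE := calB_sup_weight_subspace.
have C t f c : 0 <= t -> calB rho f -> wbound rt c f -> wbound rt c (damped t f).
  move=> t0 Bf hf x; rewrite /damped normrM (gtr0_norm (expR_gt0 _)).
  rewrite (hpsi.2 t t0 f Bf) /=.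
  have c0 := wbound_ge0 (sup_weight_gt0 x) hf.
  have H : `|f (psi t x)| <= c * (expR (omega * t) * rt x).
    by apply: le_trans (hf _) _; rewrite ler_wpM2l// sup_weight_transport.
  rewrite -(ler_pM2l (expR_gt0 (omega * t))) mulrA -expRD mulNr subrr expR0 mul1r.
  by apply: le_trans H _; rewrite mulrCA.
split.
- by move=> t t0 f Bf; apply: (subspaceZ hE); exact: semigroup_calB.
- move=> t t0 a f g Bf Bg; rewrite /damped.
  have [_ PL _] := gf_bounded hP t0; rewrite PL//.
  by apply/funext => x; ring.
- by move=> f Bf; apply/funext => x; rewrite /damped mulr0 expR0 mul1r (gf_id hP
  Bf).
- move=> t s t0 s0 f Bf; apply/funext => x; rewrite /damped.
  have [_ PL _] := gf_bounded hP t0.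
  rewrite (linear_onZ (calB_subspace hrho) PL _ (semigroup_calB s0 Bf))
    (gf_semigroup hP t0 s0 Bf).
  by rewrite mulrA -expRD mulrDr.
- by move=> t t0 f Bf c; exact: C.
move=> f Bf e e0; have e2 : 0 < e / 2 by rewrite divr_gt0.
have [d d0 hd] := transport_strongly_continuous Pd Bf e2.
have [m [m0 hm _]] := wbound_least sup_weight_gt0 (subspace_bound hE Bf).
have w0 := transport_growth_ge0.
pose K := 2 * (omega * m + 1).
have K0 : 0 < K by rewrite mulr_gt0// ltr_wpDl// mulr_ge0.
exists (Num.min d (e / K)); first by rewrite lt_min d0 divr_gt0.
move=> t /andP[t0]; rewrite lt_min ltr_pdivlMr// => /andP[td tK] x.
have -> : damped t f x - f x =
  expR (- omega * t) * (P t f x - f x) + (expR (- omega * t) - 1) * f x.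
  by rewrite /damped; ring.
have e1 : expR (- omega * t) <= 1.
  by rewrite -expR0 ler_expR mulNr oppr_le0 mulr_ge0.
have e3 := expR_ge1Dx (- omega * t).
have := hd t; rewrite t0 td => /(_ isT x) H.
apply: le_trans (ler_normD _ _) _; rewrite !normrM (gtr0_norm (expR_gt0 _)).
rewrite (ler0_norm (_ : expR (- omega * t) - 1 <= 0)); last by lra.
have H1 : expR (- omega * t) * `|P t f x - f x| <= 1 * (e / 2 * rt x).
  by apply: ler_pM => //; exact: expR_ge0.
have H2 : - (expR (- omega * t) - 1) * `|f x| <= (omega * t) * (m * rt x).
  by apply: ler_pM => //; lra.
have H3 : t * K * rt x <= e * rt x by rewrite ler_pM2r ?sup_weight_gt0// ltW.
have H4 : 0 <= t * rt x by rewrite mulr_ge0// ltW// sup_weight_gt0.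
by rewrite /K in H3; lra.
Qed.

Lemma transport_resolvent :
  dense_domain rho (calB rho) (gen rho (calB rho) P) ->
  forall mu, omega < mu -> forall h, calB rho h ->
  exists f g, gen rho (calB rho) P f g /\ forall x, mu * f x - g x = h x.
Proof.
move=> Pd mu wmu h Bh; have hE := calB_sup_weight_subspace.
have M0 := transport_bound_gt0.
have eqv := gen_equiv_weight (calB rho) _ _ _ M0 weight_le_sup_weight
  sup_weight_le_weight.
have hS := damped_contraction Pd.
have Gd : dense_domain rt (calB rho) (gen rt (calB rho) damped).
  move=> f Bf e e0; have [f' [g' [gf' ff']]] := Pd f Bf e e0.
  exists f', (fun x => g' x + - omega * f' x); split.
    by apply: (gen_rescale (- omega) sup_weight_gt0 hE); apply/eqv.
  rewrite -[e]mulr1; apply: (wbound_trans (w := rho)) => //; first exact: ltW.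
  by move=> x; rewrite mul1r weight_le_sup_weight.
have k0 : 0 < mu - omega by rewrite subr_gt0.
have t0 : 0 < (mu - omega)^-1 by rewrite invr_gt0.
have [u [v [uv huv]]] := gen_resolvent sup_weight_gt0 hE hS Gd t0 (subspaceZ hE (mu
  - omega)^-1 Bh).
exists u, (fun x => v x + omega * u x); split.
  apply/eqv; have := gen_rescale omega sup_weight_gt0 hE uv.
  congr (gen _ _ _ _ _); apply/funext => t; apply/funext => f; apply/funext => x.
  by rewrite /damped mulrA -expRD mulNr subrr expR0 mul1r.
move=> x; have := huv x => /(congr1 (fun z => (mu - omega) * z)).
by rewrite mulrBr !mulrA divff ?gt_eqF// !mul1r => <-; ring.
Qed.

(** The supremum norm has no attained extrema on unbounded functions; the
    minimum principle is applied with the weights [1 + b rt] and [b] tends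
    to [0]. *)
Lemma transport_resolvent_lower f g mu m : omega <= mu -> 0 < mu -> 0 <= m ->
  gen rho (calB rho) P f g -> (forall x, - m <= mu * f x - g x) ->
  forall x, - (m / mu) <= f x.
Proof.
move=> wmu mu0 m0 gfg hfg x; have [Bf _ _] := gfg.
have K b : 0 < b -> forall y, - (m / mu * (1 + b * rt y)) <= f y.
  move=> b0; have W1 y : b * rho y <= 1 + b * rt y.
    by rewrite ler_wpDl// ler_pM2l// weight_le_sup_weight.
  have clW r : closed [set y | 1 + b * rt y <= r].
    rewrite (_ : [set y | _] = [set y | rt y <= (r - 1) / b]);
      first exact: sup_weight_lsc.
    by apply/seteqP; split=> y /=; rewrite ler_pdivlMr// lerBrDl mulrC.
  have mm : 0 <= m / mu by rewrite divr_ge0// ltW.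
  have [f0 y|[z [c [c0 fz fy]]] y] := weighted_min hX hrho Bf b0 W1 clW.
    apply: le_trans (f0 y); rewrite oppr_le0 mulr_ge0// addr_ge0// mulr_ge0// ltW//.
    exact: sup_weight_gt0.
  apply: le_trans (fy y); rewrite lerN2 ler_pM2r; last first.
    by rewrite ltr_pwDl// mulr_ge0// ltW// sup_weight_gt0.
  have := gen_at_min gfg (ltW b0) (ltW c0) fz fy; have := hfg z; rewrite fz.
  have : c * b * rt z * omega <= c * b * rt z * mu.
    by rewrite ler_wpM2l// !mulr_ge0// ltW// sup_weight_gt0.
  by rewrite ler_pdivlMr//; lra.
apply/ler_addgt0Pr => e e0.
have p := sup_weight_gt0 x.
have d0 : 0 < (m / mu + 1) * rt x by rewrite mulr_gt0// ltr_wpDl// divr_ge0// ltW.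
have := K _ (divr_gt0 e0 d0) x.
have : m / mu * (e / ((m / mu + 1) * rt x) * rt x) <= e.
  rewrite (_ : _ * _ = m / mu / (m / mu + 1) * e); last first.
    by field; rewrite !gt_eqF//; rewrite ltr_wpDl// divr_ge0// ltW.
  rewrite ger_pMl// ler_pdivrMr ?mul1r ?lerDl//.
  by rewrite ltr_wpDl// divr_ge0// ltW.
by lra.
Qed.

Lemma transport_resolvent_bound f g mu m : omega <= mu -> 0 < mu -> 0 <= m ->
  gen rho (calB rho) P f g -> (forall x, `|mu * f x - g x| <= m) ->
  forall x, `|f x| <= m / mu.
Proof.
move=> wmu mu0 m0 gfg hfg x.
have [Bf Bg h] := gfg.
have gN : gen rho (calB rho) P (fun x => - f x) (fun x => - g x).
  have hE := calB_subspace hrho.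
  split.
  - by have := subspaceZ hE (-1) Bf; congr calB; apply/funext => y; rewrite mulN1r.
  - by have := subspaceZ hE (-1) Bg; congr calB; apply/funext => y; rewrite mulN1r.
  move=> e e0; have [d d0 hd] := h e e0; exists d => // t td y.
  have t0 : 0 <= t by case/andP: td => /ltW.
  have fN : (fun x => - f x) = (fun x => -1 * f x) by apply/funext => z;
    rewrite mulN1r.
  have [_ PL _] := gf_bounded hP t0.
  rewrite fN (linear_onZ hE PL _ Bf) -normrN.
  by rewrite [X in `|X|](_ : _ = P t f y - f y - t * g y); [exact: hd|ring].
rewrite ler_norml; apply/andP; split.
  apply: (transport_resolvent_lower wmu mu0 m0 gfg) => y.
  by have := hfg y; rewrite ler_norml => /andP[].
rewrite -lerN2; apply: (transport_resolvent_lower wmu mu0 m0 gN) => y.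
by have := hfg y; rewrite ler_norml => /andP[]; lra.
Qed.

End Transport.

(** * Perturbation of the transport generator by jumps *)

Section Clamp.
Context {R : realType}.
Implicit Types (k r s t : R).

Definition clamp k t := Num.max (- k) (Num.min k t).

Lemma clamp_le k t : 0 <= k -> `|clamp k t| <= k.
Proof.
move=> k0; rewrite ler_norml /clamp le_max lexx /= ge_max ge_min lexx /= andbT.
by lra.
Qed.

Lemma clamp_norm k t : 0 <= k -> `|clamp k t| <= `|t|.
Proof.
move=> k0; have := ler_norm t; have := ler_norm (- t); rewrite normrN => h1 h2.
have h3 := normr_ge0 t; rewrite ler_norml /clamp; apply/andP.
by case: (leP k t) => ?; case: (leP (- k) k) => ?; case: (leP (- k) t) => ?;
  split; lra.
Qed.

Lemma clamp_lip k s t : 0 <= k -> `|clamp k s - clamp k t| <= `|s - t|.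
Proof.
move=> k0; have := ler_norm (s - t); have := ler_norm (t - s); rewrite distrC.
rewrite /clamp => h1 h2; rewrite ler_norml; apply/andP.
by case: (leP k s) => ?; case: (leP k t) => ?; case: (leP (- k) k) => ?;
  case: (leP (- k) s) => ?; case: (leP (- k) t) => ?; split; lra.
Qed.

Lemma clamp_excess k r t : 0 <= k -> 0 <= r -> `|t| <= k + r ->
  `|t - clamp k t| <= r.
Proof.
move=> k0 r0; rewrite !ler_norml => /andP[h1 h2]; rewrite /clamp; apply/andP.
by case: (leP k t) => ?; case: (leP (- k) k) => ?; case: (leP (- k) t) => ?;
  split; lra.
Qed.

End Clamp.

Section Perturbation.
Context {R : realType} {X : ptopologicalType} (rho : X -> R).
Context (hX : weighted_space rho).
Context (hrho : forall x, 1 <= rho x).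
Context (domA : set (X -> R)) (A : (X -> R) -> (X -> R)).
Context (hA : densely_defined_operator rho domA A).
Context (P : R -> (X -> R) -> (X -> R)).
Context (hP : generalized_feller_semigroup rho P).
Context (hAP : generates rho domA A P).
Context (psi : R -> X -> X).
Context (hpsi : transport_type rho P psi).
Context (M1 omega : R).
Context (hbound : forall t, 0 <= t -> opnorm rho (P t) <= M1 * expR (omega * t)).
Context (mu : X -> {finite_measure set (borel_type X) -> \bar R}).
Context (hB : forall f, calB rho f -> forall r, 0 <= r ->
    {within weight_sublevel rho r, continuous (jump_operator mu f)}).
Context (M : R).
Context (ha1 : forall x, (\int[mu x]_y (rho y)%:E <= (M * rho x ^+ 2)%:E)%E).
Context (ha3 : forall x, (\int[mu x]_y 1%:E <= (M * Num.sqrt (rho x))%:E)%E).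
Context (omega' : R).
Context (hb : forall x,
    (\int[mu x]_y
       (`| (sup_weight rho psi omega y - sup_weight rho psi omega x)
           / sup_weight rho psi omega x |)%:E <= omega'%:E)%E).
Implicit Types (f g h u v : X -> R).

Notation B := (jump_operator mu).
Notation rt := (sup_weight rho psi omega).
Notation genP := (gen rho (calB rho) P).

Let hE := calB_subspace hrho.
Let rho0 x : 0 < rho x := weight_gt0 hrho x.
Let rt0 x : 0 < rt x := sup_weight_gt0 hX hrho hP hpsi hbound x.
Let omega0 : 0 <= omega := transport_growth_ge0 hX hrho hP hpsi hbound.
Let rho_rt x : rho x <= rt x := weight_le_sup_weight hX hrho hP hpsi hbound x.
Let rt_rho x : rt x <= M1 * rho x := sup_weight_le_weight hX hrho hP hpsi hbound x.
Let hErt : closed_subspace rt (calB rho) :=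
  calB_sup_weight_subspace hX hrho hP hpsi hbound.

Lemma domA_gen f g : genP f g <-> domA f /\ g = A f.
Proof.
have PE t h : 0 <= t -> calB rho h -> calB rho (P t h) by exact: semigroup_calB.
have := generator_graphP f g hrho PE; rewrite -hAP => <-.
by split=> [[h Dh [<- <-]]|[Df ->]]; [|exists f].
Qed.

Lemma genP_dense : dense_domain rho (calB rho) genP.
Proof.
move=> f Bf e e0; have [DB AB _ Dd] := hA; have [g Dg fg] := Dd f Bf e e0.
exists g, (A g); split; first exact/domA_gen.
have [bfg _] : calB rho (f \- g) by exact: (subspaceB hE Bf (DB _ Dg)).
by apply: wboundW (wbound_wnorm hrho bfg); [|exact: ltW].
Qed.

Lemma domA_lin a f g : domA f -> domA g -> domA (fun x => a * f x + g x) /\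
  A (fun x => a * f x + g x) = (fun x => a * A f x + A g x).
Proof. by have [_ _ L _] := hA; exact: L. Qed.

Lemma domA_calB f : domA f -> calB rho f /\ calB rho (A f).
Proof. by have [DB AB _ _] := hA => Df; split; [exact: DB|exact: AB]. Qed.

Lemma domA0 : domA (fun=> 0) /\ A (fun=> 0) = fun=> 0.
Proof.
have [f [g [/domA_gen[Df _] _]]] := genP_dense (subspace0 hE) ltr01.
have [] := domA_lin (-1) Df Df.
rewrite (_ : (fun x => -1 * f x + f x) = fun=> 0); last first.
  by apply/funext => x; rewrite mulN1r addNr.
by move=> D0 ->; split => //; apply/funext => x; rewrite mulN1r addNr.
Qed.

Let M0 : 0 <= M := jump_growth_ge0 hrho ha3 point.

(** The truncated iteration described above: [N] counts the rounds, the term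
    [q^N] with [q = c / (lam + c)] is what remains to be solved, and
    [2 M^2 / (c lam)] is the fixed point of
    [r |-> 2 M^2 / (c (lam + c)) + q r], the total of the clamped residuals. *)
Lemma approximate_solution (lam c : R) N m g : 0 < lam -> 0 < c ->
  omega < lam + c -> 0 <= m -> calB rho g -> (forall x, `|g x| <= m) ->
  exists u, [/\ domA u, calB rho (B u) &
    wbound rho (m * ((c / (lam + c)) ^+ N + 2 * M ^+ 2 / (c * lam)))
      (fun x => g x - (lam * u x - A u x - B u x))].
Proof.
move=> lam0 c0 wlc; have lc0 : 0 < lam + c by rewrite addr_gt0.
elim: N m g => [|N IH] m g m0 Bg hg.
  have [D0 A0] := domA0.
  have B0 : B (fun=> 0) = fun=> 0.
    by apply: (linear_on0 hE); move=> a f h; exact: (jump_linear hX hrho ha1).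
  exists (fun=> 0); split => //; first by rewrite B0; exact: subspace0 hE.
  move=> x; rewrite A0 B0 mulr0 !subr0 expr0.
  apply: (@le_trans _ _ (m * rho x)); first exact: (wbound_of_bounded hrho hg).
  rewrite ler_pM2r// ler_peMr// lerDl divr_ge0// ?mulr_ge0 ?exprn_ge0//; exact: ltW.
have [v [av [gv hv]]] := transport_resolvent hX hrho hP hpsi hbound genP_dense wlc
  Bg.
have hvb : forall x, `|v x| <= m / (lam + c).
  apply: (transport_resolvent_bound hX hrho hP hpsi hbound (ltW wlc) lc0 m0 gv) =>
    x.
  by rewrite hv.
have /domA_gen[Dv av_eq] := gv; have [Bv _ _] := gv.
pose n := m / (lam + c); have n0 : 0 <= n by rewrite divr_ge0// ltW.
have BBv : calB rho (B v) by exact: (jump_calB hX hrho ha1 ha3 hB Bv hvb).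
pose T x := B v x + c * v x.
have BT : calB rho T by apply: (subspaceD hE BBv); exact: (subspaceZ hE).
have hT x : `|T x| <= c * n + 2 * M ^+ 2 * n / c * rho x.
  exact: (jump_bound_excess hX hrho ha1 ha3 x c0 Bv hvb).
have cn0 : 0 <= c * n by rewrite mulr_ge0// ltW.
pose g' x := clamp (c * n) (T x).
have Bg' : calB rho g'.
  by apply: (calB_contraction hX hrho BT) => *;
    [exact: clamp_norm|exact: clamp_lip].
have hg' x : `|g' x| <= c * n by exact: clamp_le.
have [u [Du Bu hu]] := IH _ _ cn0 Bg' hg'.
have [Buu _] := domA_calB Du.
have := domA_lin 1 Dv Du; rewrite (_ : (fun x => 1 * v x + u x) = (fun x => v x + u
  x)); last first.
  by apply/funext => x; rewrite mul1r.
move=> [Dvu Avu].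
have Bvu : B (fun x => v x + u x) = (fun x => B v x + B u x).
  by apply: (linear_onD (E := calB rho)) => //; move=> a f h;
    exact: (jump_linear hX hrho ha1).
exists (fun x => v x + u x); split => //; first by rewrite Bvu;
  exact: (subspaceD hE).
move=> x; rewrite Avu Bvu mul1r.
have -> : g x - (lam * (v x + u x) - (A v x + A u x) - (B v x + B u x)) =
    (T x - g' x) + (g' x - (lam * u x - A u x - B u x)).
  by rewrite -hv /T av_eq; ring.
apply: le_trans (ler_normD _ _) _.
have r0 : 0 <= 2 * M ^+ 2 * n / c * rho x.
  by rewrite !mulr_ge0 ?invr_ge0 ?exprn_ge0// ltW.
apply: le_trans (lerD (clamp_excess cn0 r0 (hT x)) (hu x)) _.
rewrite [_ ^+ N.+1]exprS /n [leLHS](_ : _ = m * (c / (lam + c) * (c / (lam + c)) ^+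
  N +
  2 * M ^+ 2 / (c * lam)) * rho x)//.
set q := (c / (lam + c)) ^+ N; field.
by rewrite !gt_eqF.
Qed.

Let w0 := omega + omega'.

(** The shift by [omega + omega'] makes the sum dissipative in the weight
    [rt]. *)
Definition shifted_sum f k :=
  sum_domain rho domA B f /\ k = (fun x => A f x + B f x - w0 * f x).

Lemma omega'_ge0 : 0 <= omega'.
Proof.
rewrite -lee_fin; apply: le_trans (hb point); apply: integral_ge0 => y _.
by rewrite lee_fin.
Qed.

Lemma shifted_sumE f k : shifted_sum f k -> calB rho f /\ calB rho k.
Proof.
move=> [[Df BBf] ->]; have [Bf BAf] := domA_calB Df; split => //.
by apply: (subspaceB hE); [exact: (subspaceD hE)|exact: (subspaceZ hE)].
Qed.

Lemma shifted_sum_linear : linear_graph shifted_sum.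
Proof.
have LB : linear_on (calB rho) B by move=> a f h; exact: (jump_linear hX hrho ha1).
split.
  have [D0 A0] := domA0; have B0 : B (fun=> 0) = fun=> 0 by exact: (linear_on0 hE
    LB).
  split; last by rewrite A0 B0; apply/funext => x; rewrite mulr0 addr0 subrr.
  by split => //=; rewrite B0; exact: subspace0 hE.
move=> a f k f' k' [[Df Bf] ->] [[Df' Bf'] ->].
have [D1 A1] := domA_lin a Df Df'.
have B1 := LB a f f' (domA_calB Df).1 (domA_calB Df').1.
split; last by rewrite A1 B1; apply/funext => x; ring.
by split => //=; rewrite B1; exact: (subspace_lin hE).
Qed.

Lemma shifted_sum_dissipative : lower_dissipative rt shifted_sum.
Proof.
move=> tau tau0 f k [[Df BBf] ->] c c0 hc x.
have [Bf BAf] := domA_calB Df.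
have W1 y : 1 * rho y <= rt y by rewrite mul1r.
have [f0|[z [d [d0 fz fy]]]] :=
    weighted_min hX hrho Bf ltr01 W1 (sup_weight_lsc hX hrho hP hpsi hbound).
  by apply: le_trans (f0 x); rewrite oppr_le0 mulr_ge0// ltW.
have gA : genP f (A f) by apply/domA_gen.
have hAz : - (d * (1 * omega * rt z)) <= A f z.
  apply: (gen_at_min hX hrho hP hpsi hbound (a := 0) gA) => //; first exact: ltW.
    by rewrite mul1r add0r.
  by move=> y; rewrite mul1r add0r.
have hBz := jump_at_min hX hrho ha1 (ltW d0) Bf (rt0 z) (sup_weight_lsc hX hrho hP
  hpsi hbound)
  (hb z) fz fy.
have dc : d * rt z <= c * rt z.
  have : 0 <= tau * (A f z + B f z - w0 * f z).
    by apply: mulr_ge0; [exact: ltW|rewrite fz /w0; lra].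
  by have := hc z; rewrite fz; lra.
rewrite ler_pM2r// in dc.
by apply: le_trans (fy x); rewrite lerN2 ler_pM2r.
Qed.

Lemma jump_bounded_dom f m : domA f -> (forall x, `|f x| <= m) ->
  sum_domain rho domA B f.
Proof.
move=> Df hm; split => //=; have [Bf _] := domA_calB Df.
exact: (jump_calB hX hrho ha1 ha3 hB Bf hm).
Qed.

Lemma wbound_sup_weight c f : 0 <= c -> wbound rho c f -> wbound rt c f.
Proof.
move=> c0 h; rewrite -[c]mulr1; apply: (wbound_trans (w := rho)) => // x.
by rewrite mul1r.
Qed.

(** Near [f] there is [f2] in the domain of [A]; replacing [(nu - A) f2] by a
    nearby bounded function and applying the resolvent gives a bounded element
    of the domain, on which [B] is defined. *)
Lemma shifted_sum_dense : dense_domain rt (calB rho) shifted_sum.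
Proof.
move=> f Bf e e0; have e2 : 0 < e / 2 by rewrite divr_gt0.
have [f2 [a2 [g2 ff2]]] := genP_dense Bf e2; have [Bf2 Ba2 _] := g2.
pose nu := omega + 1; have wnu : omega < nu by rewrite ltrDl.
have Bh : calB rho (fun x => nu * f2 x - a2 x) by apply: (subspaceB hE) => //;
  exact: (subspaceZ hE).
have [g cg hg] := (calBP hrho _).1 Bh _ e2.
have [u [au [gu hu]]] := transport_resolvent hX hrho hP hpsi hbound genP_dense wnu
  (Cb_calB hrho cg).
have nu0 : 0 < nu by rewrite ltr_wpDl.
have [_ [m hm]] := (CbP _).1 cg.
have m0 : 0 <= m by apply: le_trans (hm point).
have hub : forall x, `|u x| <= m / nu.
  apply: (transport_resolvent_bound hX hrho hP hpsi hbound (ltW wnu) nu0 m0 gu) =>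
    x.
  by rewrite hu.
have /domA_gen[Du _] := gu; have [Bu _ _] := gu.
exists u, (fun x => A u x + B u x - w0 * u x); split.
  by split => //; exact: jump_bounded_dom hub.
have hS := damped_contraction hX hrho hP hpsi hbound genP_dense.
have eqv := gen_equiv_weight (calB rho) _ _ _ (transport_bound_gt0 hX hrho hP hpsi
  hbound) rho_rt rt_rho.
have G1 := gen_rescale (- omega) rt0 hErt ((eqv _ _ _).1 gu).
have G2 := gen_rescale (- omega) rt0 hErt ((eqv _ _ _).1 g2).
have D := graphB (gen_linear rt0 hErt hS) G2 G1.
have {}D : wbound rt (e / 2) (fun x => f2 x - u x).
  apply: (gen_dissipative rt0 hErt hS ltr01 D) => x.
  have := wbound_sup_weight (ltW e2) hg x.
  rewrite -hu /nu [X in `|X| <= _ -> _](_ : _ = f2 x - u x - 1 * (a2 x + - omega *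
    f2 x - (au x + - omega * u x)))//.
  by ring.
apply/wboundP => x; have /wboundP/(_ x)[] := D;
  have /wboundP/(_ x)[] := wbound_sup_weight (ltW e2) ff2.
by move=> *; split; lra.
Qed.

Lemma shifted_sum_range tau : 0 < tau -> dense_range rt (calB rho) shifted_sum tau.
Proof.
move=> tau0 h Bh e e0.
have et : 0 < e / tau / 2 by rewrite !divr_gt0.
have [g cg hg] := (calBP hrho _).1 (subspaceZ hE tau^-1 Bh) _ et.
have [_ [m hm]] := (CbP _).1 cg.
have m0 : 0 <= m by apply: le_trans (hm point).
pose lam := tau^-1 + w0.
have ww0 : 0 <= w0 by rewrite addr_ge0// omega'_ge0.
have lam0 : 0 < lam by rewrite ltr_wpDr// invr_gt0.
have e4 : 0 < e / tau / 4 by rewrite !divr_gt0.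
(* [c >= K] makes the total of the clamped residuals at most [e / tau / 4]. *)
pose K := m * (2 * M ^+ 2) / lam / (e / tau / 4); pose c := omega + 1 + K.
have r0 : 0 <= K.
  by rewrite !(mulr_ge0, invr_ge0) ?exprn_ge0// ?(ltW lam0)// ltW.
have c0 : 0 < c by have := omega0; rewrite /c; lra.
have wlc : omega < lam + c by rewrite /c; move: lam0; lra.
have lc0 : 0 < lam + c by rewrite addr_gt0.
have hc : m * (2 * M ^+ 2 / (c * lam)) <= e / tau / 4.
  have : K <= c by have := omega0; rewrite /c; lra.
  rewrite /K.
  rewrite ler_pdivrMr// => H.
  rewrite (_ : _ * _ = m * (2 * M ^+ 2) / lam / c); last by field; rewrite !gt_eqF.
  by rewrite ler_pdivrMr// [e / tau / 4 * c]mulrC.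
have [N hN] : exists N, m * (c / (lam + c)) ^+ N <= e / tau / 4.
  have q0 : 0 <= c / (lam + c) by rewrite divr_ge0// ltW.
  have : (fun n => m * (c / (lam + c)) ^+ n) @ \oo --> (m * 0 : R).
    apply: cvgM; first exact: cvg_cst.
    by apply: cvg_expr; rewrite ger0_norm// ltr_pdivrMr// mul1r ltrDr.
  rewrite mulr0 => /cvgrPdist_le /(_ _ e4) [n _ /(_ n (leqnn n))].
  by rewrite sub0r normrN => /(le_trans (ler_norm _)); exists n.
have [u [Du Bu hu]] := approximate_solution N lam0 c0 wlc m0 (Cb_calB hrho cg) hm.
exists u, (fun x => A u x + B u x - w0 * u x); split; first by split.
apply: wbound_sup_weight; first exact: ltW.
have {}hu : wbound rho (e / tau / 2) (fun x => g x - (lam * u x - A u x - B u x)).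
  apply: wboundW hu => //; rewrite mulrDr; apply: le_trans (lerD hN hc) _; lra.
move=> x.
have -> : h x - (u x - tau * (A u x + B u x - w0 * u x)) =
    tau * ((tau^-1 * h x - g x) + (g x - (lam * u x - A u x - B u x))).
  by rewrite /lam; field; rewrite gt_eqF.
rewrite normrM gtr0_norm// -ler_pdivlMl//.
apply: le_trans (ler_normD _ _) _; apply: le_trans (lerD (hg x) (hu x)) _.
by rewrite [leLHS](_ : _ = tau^-1 * (e * rho x))//; field; rewrite gt_eqF.
Qed.

Theorem perturbed_semigroup : exists Pinf : R -> (X -> R) -> (X -> R),
    [/\ generalized_feller_semigroup rho Pinf,
        closure_generates rho (sum_domain rho domA B) (sum_operator A B) Pinf
      & forall t, 0 <= t -> opnorm rho (Pinf t) <= M1 * expR (w0 * t)].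
Proof.
have [S [hS gS pS]] := lumer_phillips rt0 hErt shifted_sumE shifted_sum_linear
  shifted_sum_dissipative shifted_sum_dense shifted_sum_range.
pose Q t f x := expR (w0 * t) * S t f x.
have M10 : 0 < M1 := transport_bound_gt0 hX hrho hP hpsi hbound.
have QE t f : 0 <= t -> calB rho f -> calB rho (Q t f).
  by move=> t0 Bf; apply: (subspaceZ hE); exact: (csg_stable hS).
have Qle t f : 0 <= t -> calB rho f -> wnorm rho f <= 1 ->
    wnorm rho (Q t f) <= M1 * expR (w0 * t).
  move=> t0 Bf f1; have [bf _] := Bf; apply: (wnorm_le hrho) => x.
  have h1 : wbound rho 1 f by apply: wboundW (wbound_wnorm hrho bf).
  have := csg_contr hS t0 Bf (wbound_sup_weight ler01 h1) x; rewrite mul1r => h.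
  rewrite /Q normrM gtr0_norm ?expR_gt0// mulrAC [leRHS]mulrC ler_pM2l ?expR_gt0//.
  exact: le_trans h (rt_rho x).
have inQ t : 0 <= t -> unit_ball_image rho (Q t) `<=` [set z | z <= M1 * expR (w0 *
  t)].
  by move=> t0 _ [f [Bf f1] <-]; exact: Qle.
have opQ t : 0 <= t -> opnorm rho (Q t) <= M1 * expR (w0 * t).
  move=> t0; apply: ge_sup; last exact: inQ.
  exists (wnorm rho (Q t (fun=> 0))), (fun=> 0) => //; split;
    first exact: subspace0 hE.
  by apply: (wnorm_le hrho) => x; rewrite normr0 mul1r ltW.
exists Q; split => //.
- split.
  + move=> t t0; split; first by move=> f; exact: QE.
      move=> a f g Bf Bg; rewrite /Q (csg_linear hS t0)//.
      by apply/funext => x; ring.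
    by exists (M1 * expR (w0 * t)) => z; exact: inQ.
  + by move=> f Bf; apply/funext => x; rewrite /Q mulr0 expR0 mul1r (csg0 hS).
  + move=> t s t0 s0 f Bf; apply/funext => x; rewrite /Q.
    rewrite (linear_onZ hErt (csg_linear hS t0) _ (csg_stable hS s0 Bf)) (csgD
      hS)//.
    by rewrite mulrA -expRD mulrDr.
  + move=> f Bf x; rewrite -[f x]mul1r; apply: cvgM.
      rewrite -expR0 -[X in expR X](mulr0 w0).
      apply: cvg_at_right_filter; apply: continuous_comp;
        last exact: continuous_expR.
      by apply: cvgM; [exact: cvg_cst|exact: cvg_id].
    apply/cvgrPdist_le => e e0.
    have [d d0 hd] := csg_cont hS Bf (divr_gt0 e0 (rt0 x)).
    exists d => //= t; rewrite /ball /= sub0r normrN => td t0.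
    rewrite gtr0_norm// in td.
    have := hd t; rewrite (ltW t0) td => /(_ isT x).
    by rewrite mulfVK ?gt_eqF// distrC.
  + exists (M1 * expR w0), 1; split => // t /andP[t0 t1].
    apply: le_trans (opQ t t0) _; rewrite ler_pM2l// ler_expR.
    by rewrite ler_piMr// addr_ge0// omega'_ge0.
  + move=> t t0 f Bf f0 x; rewrite /Q mulr_ge0 ?expR_ge0//; exact: pS.
- apply/seteqP.
  have eqv := gen_equiv_weight (calB rho) _ _ _ M10 rho_rt rt_rho.
  have key f k : calB rho f -> calB rho k ->
      generator_graph rho Q (f, k) <->
      closure_of_graph rt (calB rho) shifted_sum f (fun x => k x - w0 * f x).
    move=> Bf Bk; split.
      move=> /(generator_graphP _ _ hrho QE) /eqv /(gen_rescale (- w0) rt0 hErt) H.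
      apply/gS; move: H; congr (gen _ _ _ _ _).
        apply/funext => t; apply/funext => h; apply/funext => x.
        by rewrite /Q mulrA -expRD mulNr addNr expR0 mul1r.
      by apply/funext => x; rewrite mulNr.
    move=> /gS /(gen_rescale w0 rt0 hErt) H.
    apply/(generator_graphP _ _ hrho QE)/eqv; move: H; congr (gen _ _ _ _ _).
    by apply/funext => x; rewrite subrK.
  have ww0 : 0 <= w0 by rewrite addr_ge0// omega'_ge0.
  split=> -[f k].
    move=> [/= Bf Bk h]; apply/key => //; split => //.
      by apply: (subspaceB hE) => //; exact: (subspaceZ hE).
    move=> e e0; have e1 : 0 < e / (1 + w0) by rewrite divr_gt0// ltr_pwDl.
    have [_ [f' Df' <-] /= [ff' kk']] := h _ e1.
    have Gf' : shifted_sum f' (fun x => A f' x + B f' x - w0 * f' x) by split.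
    exists f', (fun x => A f' x + B f' x - w0 * f' x); split => //.
      apply: wbound_sup_weight; first exact: ltW.
      have [b1 _] : calB rho (f \- f') by exact: (subspaceB hE Bf (shifted_sumE
        Gf').1).
      apply: wboundW (wbound_wnorm hrho b1) => //.
      apply: le_trans (ltW ff') _; rewrite ler_pdivrMr ?ltr_pwDl// ler_peMr ?(ltW
        e0)//.
      by rewrite lerDl.
    apply: wbound_sup_weight; first exact: ltW.
    have [b1 _] : calB rho (f \- f') by exact: (subspaceB hE Bf (shifted_sumE
      Gf').1).
    have Bs : calB rho (A f' \+ B f').
      by apply: (subspaceD hE) Df'.2; have [] := domA_calB Df'.1.
    have [b2 _] : calB rho (k \- sum_operator A B f') by exact: (subspaceB hE Bk
      Bs).
    have H1 := wboundW rho0 (ltW ff') (wbound_wnorm hrho b1).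
    have H2 := wboundW rho0 (ltW kk') (wbound_wnorm hrho b2).
    apply/wboundP => x; have /wboundP/(_ x)[] := H2; have [] := wboundZ x ww0 H1.
    have : e * rho x = e / (1 + w0) * rho x + w0 * (e / (1 + w0) * rho x).
      by field; rewrite gt_eqF// ltr_pwDl.
    by rewrite /sum_operator /= => *; split; lra.
  move=> H; have [/= Bf Bk _] := H; move: H => /key[] // _ _ h.
  split => // e e0.
  (* The factor [1 + w0] pays for the shift by [w0], and [M1] for the change of
     weight. *)
  have e1 : 0 < e / 2 / M1 / (1 + w0) by rewrite !divr_gt0// ltr_pwDl.
  have [f' [k' [[Df' ->] ff' kk']]] := h _ e1.
  have q1 : 0 < 1 + w0 by rewrite ltr_pwDl.
  have toe c g : wbound rt c g -> 0 <= c -> wbound rho (c * M1) g.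
    by move=> hg c0; apply: (wbound_trans (w := rt)).
  exists (f', sum_operator A B f'); first by exists f'.
  have H1 := toe _ _ ff' (ltW e1); have H2 := toe _ _ kk' (ltW e1).
  have ee : e / 2 / M1 / (1 + w0) * M1 = e / 2 / (1 + w0) by field; rewrite !gt_eqF.
  rewrite ee in H1 H2.
  split => /=.
    apply: le_lt_trans (wnorm_le hrho H1) _.
    rewrite ltr_pdivrMr//; have : 0 <= e * w0 by rewrite mulr_ge0// ltW.
    by lra.
  apply: (@le_lt_trans _ _ (e / 2)); last by lra.
  apply: (wnorm_le hrho); apply/wboundP => x.
  have /wboundP/(_ x)[] := H2; have [] := wboundZ x ww0 H1.
  have : e / 2 * rho x = e / 2 / (1 + w0) * rho x + w0 * (e / 2 / (1 + w0) * rho x).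
    by field; rewrite gt_eqF.
  by rewrite /sum_operator /= => *; split; lra.
Qed.

End Perturbation.

Theorem proposition3p3 (R : realType) (X : ptopologicalType) (rho : X -> R)
  (hX : weighted_space rho) (hrho : forall x, 1 <= rho x)
  (domA : set (X -> R)) (A : (X -> R) -> (X -> R))
  (hA : densely_defined_operator rho domA A)
  (P : R -> (X -> R) -> (X -> R))
  (hP : generalized_feller_semigroup rho P)
  (hAP : generates rho domA A P)
  (psi : R -> X -> X) (hpsi : transport_type rho P psi)
  (M1 omega : R)
  (hbound : forall t, 0 <= t -> opnorm rho (P t) <= M1 * expR (omega * t))
  (hinv : forall t, 0 <= t -> forall f,
    calB (fun x => Num.sqrt (rho x)) f ->
    calB (fun x => Num.sqrt (rho x)) (P t f))
  (hcont : strongly_continuous (fun x => Num.sqrt (rho x)) P)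
  (mu : X -> {finite_measure set (borel_type X) -> \bar R})
  (hB : forall f, calB rho f -> forall r, 0 <= r ->
    {within weight_sublevel rho r, continuous (jump_operator mu f)})
  (M : R)
  (ha1 : forall x, (\int[mu x]_y (rho y)%:E <= (M * rho x ^+ 2)%:E)%E)
  (ha2 : forall x,
    (\int[mu x]_y (Num.sqrt (rho y))%:E <= (M * rho x)%:E)%E)
  (ha3 : forall x, (\int[mu x]_y 1%:E <= (M * Num.sqrt (rho x))%:E)%E)
  (omega' : R)
  (hb : forall x,
    (\int[mu x]_y
       (`| (sup_weight rho psi omega y - sup_weight rho psi omega x)
           / sup_weight rho psi omega x |)%:E <= omega'%:E)%E) :
  exists Pinf : R -> (X -> R) -> (X -> R),
    [/\ generalized_feller_semigroup rho Pinf,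
        closure_generates rho (sum_domain rho domA (jump_operator mu))
          (sum_operator A (jump_operator mu)) Pinf
      & forall t, 0 <= t ->
          opnorm rho (Pinf t) <= M1 * expR ((omega + omega') * t)].
Proof.
exact: (@perturbed_semigroup R X rho hX hrho domA A hA P hP hAP psi hpsi M1 omega
  hbound mu hB M ha1 ha3 omega' hb).
Qed.
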